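(* Let $G$ be a PSP-group. Then $G$ is generalized Bassian if, and only if, it is a B+E-group.
   Context: All groups are abelian. A PSP-group is constructed as follows: let $T=\bigoplus_p T_p$ be a torsion group, with $p$-primary components $T_p$, such that each $T_p$ is bounded (i.e., $p^nT_p=0$ for some $n$ depending on $p$); a group $G$ is a PSP-group if it is (isomorphic to) a pure subgroup of $\prod_p T_p$ containing $T$ for some such $T$. A group $G$ is Bassian (respectively, generalized Bassian) if, for every subgroup $N$ of $G$, the existence of an injective homomorphism $G\to G/N$ implies that $N=\{0\}$ (respectively, that $N$ is a direct summand of $G$). A torsion group $E$ is elementary if, for every prime $p$, its $p$-primary component $E_p$ satisfies $pE_p=0$. A group $G$ is a B+E-group if it decomposes as $G=A\oplus E$, where $A$ is Bassian and $E$ is elementary. *)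

(* Defs.v *)
(* Abelian groups are [zmodType]s, written additively; a subgroup of [G] is an
   element of [zmodClosed G], and [Quotient.quot N] is the quotient [G / N].
   Subgroups are boolean predicates, which is no restriction in the classical
   setting of [boolp]. *)
From HB Require Import structures.
From mathcomp Require Import all_boot all_algebra.
From mathcomp Require Import boolp classical_sets functions cardinality.

Set Implicit Arguments.
Unset Strict Implicit.
Unset Printing Implicit Defensive.

Import GRing.Theory.

Local Open Scope classical_set_scope.
Local Open Scope ring_scope.

Section Subgroup.
Variables (G : zmodType) (S : zmodClosed G).

Record subgroup := Subgroup {subgroup_val : G; _ : subgroup_val \in S}.

HB.instance Definition _ := [isSub of subgroup for subgroup_val].
HB.instance Definition _ := [Choice of subgroup by <:].
HB.instance Definition _ := [SubChoice_isSubZmodule of subgroup by <:].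

End Subgroup.

Section DirectProduct.
Variables (I : Type) (T : I -> zmodType).

Definition dirprod : Type := forall i, T i.

HB.instance Definition _ := Choice.copy dirprod (forall i, T i).

Let zero : dirprod := fun=> 0.
Let opp (x : dirprod) : dirprod := fun i => - x i.
Let add (x y : dirprod) : dirprod := fun i => x i + y i.

Let addA : associative add.
Proof. by move=> x y z; apply: functional_extensionality_dep => i; exact: addrA. Qed.

Let addC : commutative add.
Proof. by move=> x y; apply: functional_extensionality_dep => i; exact: addrC. Qed.

Let add0 : left_id zero add.
Proof. by move=> x; apply: functional_extensionality_dep => i; exact: add0r. Qed.

Let addN : left_inverse zero opp add.
Proof. by move=> x; apply: functional_extensionality_dep => i; exact: addNr. Qed.

HB.instance Definition _ := GRing.isZmodule.Build dirprod addA addC add0 addN.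

(* The direct sum of the [T i], as a set of elements of their product. *)
Definition dirsum : set dirprod := [set x | finite_set [set i | x i != 0]].

End DirectProduct.

Definition isomorphic (U V : zmodType) : Prop :=
  exists f : {additive U -> V}, bijective f.

Definition internal_dirsum (G : zmodType) (A B : zmodClosed G) : Prop :=
  (forall x, x \in A -> x \in B -> x = 0) /\
  (forall x, exists a b, [/\ a \in A, b \in B & x = a + b]).

Definition direct_summand (G : zmodType) (N : zmodClosed G) : Prop :=
  exists K : zmodClosed G, internal_dirsum N K.

Definition pure (G : zmodType) (H : zmodClosed G) : Prop :=
  forall (n : nat) (h : G), (0 < n)%N -> h \in H ->
    (exists g, g *+ n = h) -> exists2 h', h' \in H & h' *+ n = h.

Definition embeds_in_quotient (G : zmodType) (N : zmodClosed G) : Prop :=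
  exists f : {additive G -> Quotient.quot N}, injective f.

Definition Bassian (G : zmodType) : Prop :=
  forall N : zmodClosed G, embeds_in_quotient N -> forall x, x \in N -> x = 0.

Definition generalized_Bassian (G : zmodType) : Prop :=
  forall N : zmodClosed G, embeds_in_quotient N -> direct_summand N.

Definition torsion (G : zmodType) : Prop :=
  forall x : G, exists2 n, (0 < n)%N & x *+ n = 0.

Definition primary_component (G : zmodType) (p : nat) : set G :=
  [set x | exists n, x *+ (p ^ n) = 0].

Definition elementary (E : zmodType) : Prop :=
  torsion E /\
  forall p, prime p -> forall x : E, primary_component p x -> x *+ p = 0.

Definition BplusE (G : zmodType) : Prop :=
  exists A E : zmodClosed G,
    [/\ internal_dirsum A E, Bassian (subgroup A) & elementary (subgroup E)].

Definition prime_number : Type := {p : nat | prime p}.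

Definition bounded_pgroup (p : nat) (U : zmodType) : Prop :=
  exists n, forall x : U, x *+ (p ^ n) = 0.

(* The torsion group T is given by the family of its primary components: a
   family of groups [T p] is that of the primary components of its direct sum
   as soon as each [T p] is a p-group, which boundedness implies. *)
Definition PSP (G : zmodType) : Prop :=
  exists T : prime_number -> zmodType,
    (forall p : prime_number, bounded_pgroup (sval p) (T p)) /\
    exists H : zmodClosed (dirprod T),
      [/\ pure H, forall x, dirsum x -> x \in H & isomorphic G (subgroup H)].

(* Main.v *)
From HB Require Import structures.
Require Import Defs.
From mathcomp Require Import all_boot all_algebra.
From mathcomp Require Import boolp classical_sets cardinality.

Set Implicit Arguments.
Unset Strict Implicit.
Unset Printing Implicit Defensive.

Import GRing.Theory.

Local Open Scope classical_set_scope.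
Local Open Scope quotient_scope.
Local Open Scope ring_scope.

(** Both properties are equivalent, for a PSP-group [G], to a third one: the
    torsion-free rank of [G] is finite, and for each prime [p] the multiples of
    [p] in the component [G_p] form a finite group ([finite_rank],
    [multiples]). The PSP-condition enters through projections [pi p] of [G]
    onto its components, which have [p]-divisible kernels and together
    separate points ([PSP_projections]). They commute with all endomorphisms,
    so they restrict to direct summands.

    Suppose [G] is generalized Bassian. If the multiples of [p] in [G_p] were
    infinite in number, then [G_p] would contain infinitely many independent
    cyclic groups of order [p ^ j.+1], [j > 0], that form a summand; a shift of
    their generators embeds [G] in its quotient by a group generated by one
    element of the socle that is divisible by [p], which is no summand
    ([multiples_step]). If the rank were infinite, [G = A + E] with [E]
    elementary and [A] generated by no more elements than the rank of [G]; an
    independent family indexed by these generators then yields an embedding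
    of [G] in its quotient by a nonzero torsion-free subgroup. Such a subgroup
    is no summand: the projections map it to torsion, so they would vanish on
    it ([infinite_rank_not_gB]).

    Suppose conversely that the third property holds, and let [V_p] be the
    finite group spanned by the [p]-components of finitely many elements that
    carry the rank. Every element of [G] has almost all of its components in
    the [V_p], so decompositions of the [G_p] can be assembled to one of [G]
    whenever the first parts contain almost all [V_p] ([assemble]). Splitting
    [G_p] into a finite group around [V_p] and an elementary group gives
    [G = A + E] with [E] elementary and [A] of finite rank with finite
    components. Such a group is Bassian: if it embeds in its quotient by [N],
    then [N] is torsion, for the rank cannot drop, and [N] avoids every finite subgroup that the embedding preserves, by the
    pigeonhole principle ([graph_finite_stable]). The same principle, applied
    for almost all [p] to the sum of [V_p] and the multiples of [p], and for
    the remaining [p] to the multiples of [p] alone, makes the components of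
    [N] split off compatibly, so [G] is generalized Bassian
    ([finite_rank_gB]).

    Finally, if [G = A + E] with [A] Bassian and [E] elementary, then [A] is
    generalized Bassian, hence has the third property, and [E] affects neither
    the rank nor the multiples of [p] ([BplusE_finite]). *)

(** * Subgroups as classical sets *)

Definition subgp (G : zmodType) (S : set G) : Prop :=
  S 0 /\ forall x y, S x -> S y -> S (x - y).

Section SubgroupSets.
Variable G : zmodType.
Implicit Types (S A B N : set G) (x y : G).

Lemma subgpB S x y : subgp S -> S x -> S y -> S (x - y).
Proof. by move=> [_]; apply. Qed.

Lemma subgpN S x : subgp S -> S x -> S (- x).
Proof. by move=> hS Sx; rewrite -sub0r; apply: subgpB => //; case: hS. Qed.

Lemma subgpD S x y : subgp S -> S x -> S y -> S (x + y).
Proof. by move=> hS Sx Sy; rewrite -[y]opprK; apply: subgpB => //; exact: subgpN. Qed.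

Lemma subgpMn S x n : subgp S -> S x -> S (x *+ n).
Proof.
move=> hS Sx; elim: n => [|n IHn]; first by rewrite mulr0n; case: hS.
by rewrite mulrS; exact: subgpD.
Qed.

Lemma subgpMz S x (c : int) : subgp S -> S x -> S (x *~ c).
Proof.
by move=> hS Sx; case: c => n; [|apply: subgpN => //]; exact: subgpMn.
Qed.

Lemma subgp_sum S (I : Type) (r : seq I) (P : pred I) (F : I -> G) :
  subgp S -> (forall i, P i -> S (F i)) -> S (\sum_(i <- r | P i) F i).
Proof.
move=> hS hF; apply: (big_ind S) => //; first by case: hS.
by move=> x y; exact: subgpD.
Qed.

Lemma subgp0 : subgp [set (0 : G)].
Proof. by split=> [//|x y /= -> ->]; rewrite subr0. Qed.

Lemma subgpI A B : subgp A -> subgp B -> subgp (A `&` B).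
Proof.
move=> hA hB; split; first by split; [case: hA|case: hB].
by move=> x y [? ?] [? ?]; split; exact: subgpB.
Qed.

Definition sumset A B : set G :=
  [set x | exists a b, [/\ A a, B b & x = a + b]].

Lemma subgp_sumset A B : subgp A -> subgp B -> subgp (sumset A B).
Proof.
move=> hA hB; split.
  by exists 0, 0; rewrite addr0; split=> //; [case: hA|case: hB].
move=> _ _ [a [b [Aa Bb ->]]] [a' [b' [Aa' Bb' ->]]].
by exists (a - a'), (b - b'); split; [exact: subgpB|exact: subgpB|rewrite addrACA opprD].
Qed.

Lemma sumsetl A B : subgp B -> A `<=` sumset A B.
Proof. by move=> [B0 _] x Ax; exists x, 0; rewrite addr0. Qed.

Lemma sumsetr A B : subgp A -> B `<=` sumset A B.
Proof. by move=> [A0 _] x Bx; exists 0, x; rewrite add0r. Qed.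

Definition span A : set G := [set x | forall S, subgp S -> A `<=` S -> S x].

Lemma subgp_span A : subgp (span A).
Proof.
split=> [S [] //|x y hx hy S hS AS].
by apply: subgpB => //; [exact: hx|exact: hy].
Qed.

Lemma sub_span A : A `<=` span A.
Proof. by move=> x Ax S _; exact. Qed.

Lemma span_min A S : subgp S -> A `<=` S -> span A `<=` S.
Proof. by move=> hS AS x; exact. Qed.

Lemma span_mono A B : A `<=` B -> span A `<=` span B.
Proof.
by move=> AB; apply: span_min (subgp_span _) _ => x /AB; exact: sub_span.
Qed.

Lemma span1 x y : span [set x] y -> exists c, y = x *~ c.
Proof.
move=> xy; apply: (xy [set w | exists c, w = x *~ c]); last first.
  by move=> _ ->; exists 1.
split; first by exists 0.
by move=> _ _ [c ->] [d ->]; exists (c - d); rewrite mulrzBr.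
Qed.

(** If a multiple of [x] prime to the order of [x] lies in a subgroup, so does
    [x] itself: invert the factor modulo the order. *)
Lemma coprime_subgp S x (m n : nat) :
  subgp S -> coprime m n -> S (x *+ m) -> S (x *+ n) -> S x.
Proof.
move=> hS; have [->|m_gt0] := posnP m.
  by rewrite /coprime gcd0n => /eqP-> _; rewrite mulr1n.
move=> /eqP co Sm Sn; have [u v e _] := egcdnP n m_gt0.
have -> : x = x *+ m *+ u - x *+ n *+ v.
  rewrite -!mulrnA (mulnC m) (mulnC n) e co addnC mulrnDr mulr1n addrK //.
by apply: subgpB => //; exact: subgpMn.
Qed.

Lemma coprime_order x (m n : nat) :
  coprime m n -> x *+ m = 0 -> x *+ n = 0 -> x = 0.
Proof. by move=> co hm hn; exact: (coprime_subgp subgp0 co hm hn). Qed.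

Lemma prime_subgpz S x (p : nat) (c : int) : subgp S -> prime p ->
  ~ (p%:Z %| c)%Z -> S (x *+ p) -> S (x *~ c) -> S x.
Proof.
move=> hS pp npc Sp Sc.
have Sa : S (x *+ `|c|%N).
  by case: (c) Sc => m //= /(subgpN hS); rewrite opprK.
apply: (coprime_subgp hS _ Sp Sa); rewrite prime_coprime //.
by apply/negP => h; apply: npc.
Qed.

Definition torsion_elt x : Prop := exists2 n, (0 < n)%N & x *+ n = 0.

Lemma subgp_torsion : subgp torsion_elt.
Proof.
split; first by exists 1%N.
move=> x y [m m0 hm] [n n0 hn]; exists (m * n)%N; first by rewrite muln_gt0 m0.
by rewrite mulrnBl mulrnA hm mul0rn mulnC mulrnA hn mul0rn subr0.
Qed.

Lemma torsion_eltMn x n : (0 < n)%N -> torsion_elt (x *+ n) -> torsion_elt x.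
Proof.
by move=> n0 [m m0]; rewrite -mulrnA => h; exists (n * m)%N; rewrite ?muln_gt0 ?n0.
Qed.

End SubgroupSets.

Definition pack_pred (G : zmodType) (S : set G) (hS : subgp S) : {pred G} :=
  [pred x | `[< S x >]].

Lemma pack_closed (G : zmodType) (S : set G) (hS : subgp S) :
  GRing.zmod_closed (pack_pred hS).
Proof.
split=> [|x y /asboolP Sx /asboolP Sy]; apply/asboolP; first by case: hS.
exact: subgpB.
Qed.

HB.instance Definition _ (G : zmodType) (S : set G) (hS : subgp S) :=
  GRing.isZmodClosed.Build G (pack_pred hS) (pack_closed hS).

Definition pack (G : zmodType) (S : set G) (hS : subgp S) : zmodClosed G :=
  pack_pred hS.

Lemma packP (G : zmodType) (S : set G) (hS : subgp S) x : x \in pack hS <-> S x.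
Proof. exact: rwP2 idP (asboolP _). Qed.

Lemma subgp_mem (G : zmodType) (N : zmodClosed G) : subgp [set x | x \in N].
Proof. by split=> [|x y /= Nx Ny]; [exact: rpred0|exact: rpredB]. Qed.

Definition direct (G : zmodType) (A B : set G) : Prop :=
  (forall x, A x -> B x -> x = 0) /\ (forall x, sumset A B x).

(** An additive map is pinned down by compatibility with subtraction. *)
Lemma additive_exists (U V : zmodType) (f : U -> V) :
  {morph f : x y / x - y} -> exists g : {additive U -> V}, g =1 f.
Proof.
move=> fB; pose h := GRing.isZmodMorphism.Build U V f fB.
by exists (HB.pack_for {additive U -> V} f h).
Qed.

Lemma direct_proj (G : zmodType) (A E : set G) : subgp A -> subgp E -> direct A E ->
  exists rho : {additive G -> G}, [/\ forall x, A (rho x),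
    forall x, A x -> rho x = x & forall x, E (x - rho x)].
Proof.
move=> hA hE [AE0 AEs].
have h x : exists a, A a /\ E (x - a).
  by have [a [e [Aa Ee ->]]] := AEs x; exists a; split=> //; rewrite addrC addKr.
have [f fP] := choice h.
have uniq x a : A a -> E (x - a) -> f x = a.
  move=> Aa Ea; have [Af Ef] := fP x.
  apply/eqP; rewrite -subr_eq0; apply/eqP; apply: AE0; first exact: subgpB.
  have -> : f x - a = (x - a) - (x - f x) by rewrite opprB [RHS]addrC addrA subrK.
  exact: subgpB.
have fB : {morph f : x y / x - y}.
  move=> x y; have [Ax Ex] := fP x; have [Ay Ey] := fP y.
  apply: uniq; first exact: subgpB.
  by rewrite opprD addrACA -opprD; exact: subgpB.
have [rho rhoE] := additive_exists fB.
exists rho; split=> x; rewrite ?rhoE; try by case: (fP x).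
by move=> Ax; apply: uniq => //; rewrite subrr; case: hE.
Qed.

Lemma internal_pack (G : zmodType) (A E : set G) (hA : subgp A) (hE : subgp E) :
  direct A E -> internal_dirsum (pack hA) (pack hE).
Proof.
move=> [AE0 AEs]; split=> [x /packP Ax /packP Ex|x]; first exact: AE0.
by have [a [b [Aa Eb ->]]] := AEs x; exists a, b; split=> //; exact/packP.
Qed.

(** * Embeddings into quotients as relations *)

(** The graph of a monomorphism from [G] into [G / N], read as a relation on
    [G] that is saturated under [N] in its second argument. Working with this
    relation avoids choosing representatives. *)
Definition quotient_graph (G : zmodType) (N : set G) (R : G -> G -> Prop) : Prop :=
  [/\ forall x, exists y, R x y,
      forall x x' y y', R x y -> R x' y' -> R (x - x') (y - y'),
      forall x y, R x y -> (x = 0 <-> N y)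
    & forall y, N y -> R 0 y].

Lemma embeds_graph (G : zmodType) (N : zmodClosed G) :
  embeds_in_quotient N ->
  exists R, quotient_graph [set x | x \in N] R.
Proof.
move=> [f fI]; exists (fun x y => f x = \pi_(Quotient.quot N) y).
have pi0 y : (\pi_(Quotient.quot N) y = 0) <-> y \in N.
  split=> h.
    have := Quotient.idealrBE N y 0; rewrite subr0 => ->.
    by apply/eqP; rewrite h raddf0.
  have := Quotient.idealrBE N y 0; rewrite subr0 h => /esym /eqP ->.
  by rewrite raddf0.
split.
- by move=> x; exists (repr (f x)); rewrite reprK.
- by move=> x x' y y' hx hx'; rewrite !raddfB hx hx'.
- move=> x y hxy; split=> [x0|/pi0 y0].
    by apply/pi0; rewrite -hxy x0 raddf0.
  by apply: fI; rewrite hxy y0 raddf0.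
- by move=> y /pi0 ->; rewrite raddf0.
Qed.

Lemma graph_embeds (G : zmodType) (N : zmodClosed G) (R : G -> G -> Prop) :
  quotient_graph [set x | x \in N] R -> embeds_in_quotient N.
Proof.
move=> [Rt RB R0 RN].
have [g hg] := choice Rt.
have piE y y' x : R x y -> R x y' ->
    \pi_(Quotient.quot N) y = \pi_(Quotient.quot N) y'.
  move=> h h'; apply/eqP; rewrite -Quotient.idealrBE.
  by have := RB _ _ _ _ h h'; rewrite subrr => /R0 [/(_ erefl)].
have fB : {morph (fun x => \pi_(Quotient.quot N) (g x)) : x y / x - y}.
  by move=> x y; rewrite -raddfB; apply: (piE _ _ (x - y)) => //; exact: RB.
have [f fE] := additive_exists fB; exists f.
apply: raddf_inj => x; rewrite fE => gx0.
apply/(R0 _ _ (hg x)) => /=.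
by have := Quotient.idealrBE N (g x) 0; rewrite subr0 => ->; rewrite gx0 raddf0.
Qed.

Section GraphTheory.
Variables (G : zmodType) (N : set G) (R : G -> G -> Prop).
Hypothesis hR : quotient_graph N R.

Let RB : forall x x' y y', R x y -> R x' y' -> R (x - x') (y - y').
Proof. by case: hR. Qed.

Lemma graph00 : R 0 0.
Proof. by have [/(_ 0) [y hy] _ _ _] := hR; have := RB hy hy; rewrite !subrr. Qed.

Lemma graphD x x' y y' : R x y -> R x' y' -> R (x + x') (y + y').
Proof.
move=> h h'; rewrite -[x']opprK -[y']opprK; apply: RB => //.
by rewrite -[- x']sub0r -[- y']sub0r; apply: RB => //; exact: graph00.
Qed.

Lemma graphMn x y n : R x y -> R (x *+ n) (y *+ n).
Proof.
move=> h; elim: n => [|n IHn]; first exact: graph00.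
by rewrite !mulrS; exact: graphD.
Qed.

Lemma graphMz x y (c : int) : R x y -> R (x *~ c) (y *~ c).
Proof.
move=> h; case: c => n; first exact: graphMn.
rewrite NegzE !mulrNz -[- (x *~ _)]sub0r -[- (y *~ _)]sub0r.
by apply: RB; [exact: graph00|exact: graphMn].
Qed.

Lemma graph_sum (I : Type) (r : seq I) (F F' : I -> G) :
  (forall i, R (F i) (F' i)) -> R (\sum_(i <- r) F i) (\sum_(i <- r) F' i).
Proof.
move=> h; elim: r => [|i r IHr]; first by rewrite !big_nil; exact: graph00.
by rewrite !big_cons; exact: graphD.
Qed.

Lemma graph_sub x y y' : R x y -> R x y' -> N (y - y').
Proof.
move=> h h'; have := RB h h'; rewrite subrr => h0.
by have [_ _ /(_ _ _ h0) [/(_ erefl)]] := hR.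
Qed.

Lemma graph_shift x y n : R x y -> N n -> R x (y + n).
Proof. by move=> h Nn; rewrite -[x]addr0; apply: graphD => //; case: hR => _ _ _; apply. Qed.

(** A finite subgroup [W] that the embedding maps into its own image in [G / N]
    meets [N] trivially: the induced self-map of [W] is injective, hence
    surjective, so every element of [W] in [N] is the image of an element that
    the embedding kills. *)
Lemma graph_finite_stable (W : set G) (l : seq G) : subgp W ->
  (forall x, W x -> x \in l) ->
  (forall x, W x -> exists2 y, W y & R x y) ->
  forall x, W x -> N x -> x = 0.
Proof.
move=> hW Wl WR.
pose s := [seq x <- undup l | `[< W x >]].
have sP x : (x \in s) <-> W x.
  rewrite mem_filter mem_undup; split=> [/andP[/asboolP]//|Wx].
  by rewrite Wl // andbT; apply/asboolP.
pose f x := xget 0 [set y | W y /\ R x y].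
have fP x : W x -> W (f x) /\ R x (f x).
  by move=> /WR [y Wy Rxy]; apply: (@xgetPex _ 0 [set y | W y /\ R x y]); exists y.
have fI : {in s &, injective f}.
  move=> x y /sP /fP [_ hx] /sP /fP [_ hy] e.
  have := RB hx hy; rewrite e subrr => h.
  have [_ _ /(_ _ _ h) [_ R0] RN] := hR.
  apply/eqP; rewrite -subr_eq0; apply/eqP; apply: R0.
  by have := graph_sub h h; rewrite subrr.
have su : uniq s by rewrite filter_uniq ?undup_uniq.
have sub : {subset map f s <= s}.
  by move=> _ /mapP [x /sP /fP [Wfx _] ->]; apply/sP.
have [_ eqs] := uniq_min_size (eq_ind_r is_true su (map_inj_in_uniq fI)) sub
  (eq_leq (esym (size_map f s))).
have N0 : N 0 by have := graph_sub graph00 graph00; rewrite subrr.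
have [_ _ R0 _] := hR.
have pre x : W x -> N x -> x = f 0.
  move=> Wx Nx; have : x \in map f s by rewrite eqs; apply/sP.
  case/mapP => y /sP Wy e; have [_] := fP _ Wy; rewrite -e => Ryx.
  by rewrite e; congr f; apply/(R0 _ _ Ryx).
by move=> x Wx Nx; rewrite (pre x Wx Nx) -(pre 0) //; case: hW.
Qed.

End GraphTheory.

(** * Complements *)

(** A maximal subgroup between [Y] and [S] that is disjoint from [X] is almost
    a complement of [X] in [S]: if [p x] lies in it but [x] does not, then
    maximality gives a nonzero element of [X] in its extension by [x], and the
    coefficient of [x] there is prime to [p], hence can be inverted. *)
Lemma disjoint_maximal (G : zmodType) (X Y S : set G) :
  subgp X -> subgp Y -> subgp S -> Y `<=` S ->
  (forall x, X x -> Y x -> x = 0) ->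
  exists K, [/\ subgp K, Y `<=` K, K `<=` S, forall x, X x -> K x -> x = 0
    & forall p x, prime p -> S x -> K (x *+ p) -> sumset X K x].
Proof.
move=> hX hY hS YS XY.
(* The empty set stands for [Y]; it makes the property hold for the union of
   the empty chain. *)
pose ok K := [/\ subgp K, Y `<=` K, K `<=` S & forall x, X x -> K x -> x = 0].
pose P (K : set G) := K = set0 \/ ok K.
have [F FP Ftot|K [PK Kmax]] := @Zorn_bigcup _ P.
  have [[K0 FK0 K0n]|none] := pselect (exists2 K, F K & K !=set0); last first.
    left; rewrite predeqE => x; split=> // -[K FK Kx].
    by apply: none; exists K => //; exists x.
  have okF K : F K -> K !=set0 -> ok K.
    by move=> FK [x Kx]; case: (FP _ FK) => // K00; move: Kx; rewrite K00.
  right; split.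
  - split; first by exists K0 => //; case: (okF _ FK0 K0n) => -[].
    move=> x y [K FK Kx] [L FL Ly].
    have [KL|LK] := Ftot _ _ FK FL.
      exists L => //; have [hL _ _ _] : ok L by apply: okF => //; exists y.
      by apply: subgpB => //; exact: KL.
    exists K => //; have [hK _ _ _] : ok K by apply: okF => //; exists x.
    by apply: subgpB => //; exact: LK.
  - by move=> y Yy; exists K0 => //; case: (okF _ FK0 K0n) => _ + _ _; apply.
  - move=> y [K FK Ky]; have [_ _ + _] : ok K by apply: okF => //; exists y.
    exact.
  - move=> x Xx [K FK Kx]; have [_ _ _] : ok K by apply: okF => //; exists x.
    exact.
have okK : ok K.
  case: PK => // K0; have PY : P Y by right; split.
  exfalso; apply: (Kmax Y) => //; rewrite K0; split=> // h.
  by have [/h] := hY.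
have [hK YK KS XK] := okK.
exists K; split=> // p x pp Sx Kpx.
have [Kx|nKx] := pselect (K x); first exact: sumsetr.
pose L := sumset K (span [set x]).
have hL : subgp L by apply: subgp_sumset => //; exact: subgp_span.
have KL : K `<=` L by apply: sumsetl; exact: subgp_span.
have Lx : L x by apply: sumsetr => //; exact: sub_span.
have Lmul z : L z -> exists c, K (z - x *~ c).
  move=> [k [m [Kk xm ->]]].
  have [c ->] := span1 xm.
  by exists c; rewrite addrK.
have nP : ~ P L.
  apply: Kmax; split=> // h; exact: nKx (h _ Lx).
have [z [Xz Lz z0]] : exists z, [/\ X z, L z & z <> 0].
  apply: contrapT => no; apply: nP; right; split=> //.
  - by move=> y /YK /KL.
  - move=> _ [k [m [/KS Sk xm ->]]]; apply: subgpD => //.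
    by apply: (xm S) => // _ ->.
  - by move=> z Xz Lz; apply: contrapT => z0; apply: no; exists z.
have [c Kc] := Lmul _ Lz.
have hXK : subgp (sumset X K) by exact: subgp_sumset.
have xc : sumset X K (x *~ c).
  exists z, (- (z - x *~ c)); split=> //; first exact: subgpN.
  by rewrite opprB addrC subrK.
apply: (prime_subgpz hXK pp _ (sumsetr hX Kpx) xc) => /dvdzP [d cd].
apply: z0; apply: XK => //.
have -> : z = (z - x *~ c) + x *~ c by rewrite subrK.
apply: subgpD => //; rewrite cd mulrC mulrzA.
by apply: subgpMz => //; rewrite -pmulrn.
Qed.

(** * Integral combinations and independence *)

Section Combinations.
Variable I : eqType.
Implicit Types (s : seq (I * int)) (D : pred I).

Definition coef s (i : I) : int := \sum_(q <- s | q.1 == i) q.2.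

Definition supported D s : bool := all (fun q => D q.1) s.

Definition oppc s : seq (I * int) := [seq (q.1, - q.2) | q <- s].

Definition comb (G : zmodType) (u : I -> G) s : G := \sum_(q <- s) u q.1 *~ q.2.

Variable G : zmodType.
Implicit Types (u : I -> G) (S : set G).

Lemma comb_nil u : comb u [::] = 0.
Proof. exact: big_nil. Qed.

Lemma comb_cat u s t : comb u (s ++ t) = comb u s + comb u t.
Proof. exact: big_cat. Qed.

Lemma comb_oppc u s : comb u (oppc s) = - comb u s.
Proof.
rewrite /comb big_map -sumrN; apply: eq_bigr => q _.
by rewrite mulrNz.
Qed.

Lemma comb_subc u s t : comb u (s ++ oppc t) = comb u s - comb u t.
Proof. by rewrite comb_cat comb_oppc. Qed.

Lemma supported_subc D s t :
  supported D s -> supported D t -> supported D (s ++ oppc t).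
Proof. by rewrite /supported all_cat all_map => -> /=. Qed.

Lemma comb1 u i : comb u [:: (i, 1)] = u i.
Proof. by rewrite /comb big_seq1. Qed.

Lemma comb_in S D u s : subgp S -> (forall i, D i -> S (u i)) ->
  supported D s -> S (comb u s).
Proof.
move=> hS hu /allP sD; rewrite /comb big_seq; apply: subgp_sum => // q qs.
by apply: subgpMz => //; apply: hu; exact: sD.
Qed.

Lemma comb_coef u s (l : seq I) : uniq l -> {subset map fst s <= l} ->
  comb u s = \sum_(i <- l) u i *~ coef s i.
Proof.
move=> ul sl; rewrite /comb /coef.
under [RHS]eq_bigr => i _ do rewrite mulrz_sumr big_mkcond /=.
rewrite exchange_big /= !big_seq; apply: eq_bigr => q qs.
rewrite (bigD1_seq q.1) ?eqxx //=; last by apply: sl; exact: map_f.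
by rewrite big1 ?addr0 // => i; rewrite eq_sym => /negbTE ->.
Qed.

Lemma span_comb u D x : span [set y | exists2 i, D i & y = u i] x <->
  exists2 s, supported D s & x = comb u s.
Proof.
split=> [|[s sD ->]]; last first.
  by apply: comb_in sD; [exact: subgp_span|move=> i Di; apply: sub_span; exists i].
apply: (@span_min _ _ [set y | exists2 s, supported D s & y = comb u s]);
  last by move=> _ [i Di ->]; exists [:: (i, 1)];
  rewrite /supported /= ?Di // comb1.
split; first by exists [::]; rewrite ?comb_nil.
move=> _ _ [s sD ->] [t tD ->]; exists (s ++ oppc t); last by rewrite comb_subc.
exact: supported_subc.
Qed.

End Combinations.

(** Independence modulo [n]: in a relation between the [u i] with [i] in [D] the
    coefficients are multiples of [n]. The case [n = 0] is linear independence
    over the integers, the case where all [u i] have order [n] says that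
    the cyclic groups that they generate form a direct sum. *)
Definition indep (I : eqType) (G : zmodType) (n : nat) (D : pred I) (u : I -> G) : Prop :=
  forall s, supported D s -> comb u s = 0 -> forall i, (n%:Z %| coef s i)%Z.

Lemma comb_transfer (I : eqType) (G : zmodType) n (a : I -> G) s :
  (forall i, (n%:Z %| coef s i)%Z) -> (forall i, a i *+ n = 0) -> comb a s = 0.
Proof.
move=> hs an; rewrite (comb_coef a (undup_uniq (map fst s))); last first.
  by move=> i; rewrite mem_undup.
apply: big1 => i _; have /dvdzP [d ->] := hs i.
by rewrite mulrC mulrzA -pmulrn an mul0rz.
Qed.

(** Triangular independence: reading a relation from its last term on, each
    coefficient in turn is seen to be a multiple of [n]. *)
Lemma triangular_indep (G : zmodType) (B : set G) n (v : nat -> G) :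
  subgp B -> (forall i, B (v i *+ n)) ->
  (forall m d (c : nat -> int),
     B (v m *~ d + \sum_(i < m) v i *~ c i) -> (n%:Z %| d)%Z) ->
  forall m (c : nat -> int), B (\sum_(i < m) v i *~ c i) ->
  forall i, (i < m)%N -> (n%:Z %| c i)%Z.
Proof.
move=> hB vn tri; elim=> // m IHm c; rewrite big_ord_recr /= => Bs.
have dm : (n%:Z %| c m)%Z by apply: (tri m _ c); rewrite addrC.
move=> i; rewrite ltnS leq_eqVlt => /orP[/eqP->//|]; apply: IHm.
rewrite -[X in B X](addrK (v m *~ c m)); apply: subgpB => //.
have /dvdzP [d ->] := dm; rewrite mulrC mulrzA -pmulrn.
exact: subgpMz.
Qed.

Lemma comb_nat (G : zmodType) (v : nat -> G) s :
  exists2 m, comb v s = \sum_(i < m) v i *~ coef s i & forall i, (m <= i)%N -> coef s i = 0.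
Proof.
exists (\max_(q <- s) q.1).+1; last first.
  move=> i hi; rewrite /coef big_seq_cond big1 // => q /andP[qs /eqP e].
  have : (q.1 <= \max_(q <- s) q.1)%N by rewrite (big_rem q) //= leq_maxl.
  by rewrite e => h; have := leq_trans hi h; rewrite ltnn.
rewrite -(big_mkord xpredT (fun i => v i *~ coef s i)).
apply: comb_coef; first exact: iota_uniq.
move=> _ /mapP [q qs ->]; rewrite mem_index_iota ltnS.
by rewrite (big_rem q) //= leq_maxl.
Qed.

Lemma triangular_comb (G : zmodType) (B : set G) n (v : nat -> G) :
  subgp B -> (forall i, B (v i *+ n)) ->
  (forall m d (c : nat -> int),
     B (v m *~ d + \sum_(i < m) v i *~ c i) -> (n%:Z %| d)%Z) ->
  forall s, B (comb v s) -> forall i, (n%:Z %| coef s i)%Z.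
Proof.
move=> hB vn tri s; have [m -> c0] := comb_nat v s => Bs i.
have [im|/c0 ->] := ltnP i m; last exact: dvdz0.
exact: (triangular_indep hB vn tri Bs).
Qed.

Lemma sequence_of_extensions (T : choiceType) (P : seq T -> T -> Prop) :
  (forall l, exists x, P l x) -> exists f : nat -> T, forall n, P (mkseq f n) (f n).
Proof.
move=> hP; have [g gP] := choice hP.
pose L := fix L n := if n is m.+1 then rcons (L m) (g (L m)) else [::].
exists (fun n => g (L n)) => n.
suff -> : mkseq (fun n => g (L n)) n = L n by [].
elim: n => // n IHn.
by rewrite mkseqS IHn.
Qed.

(** Given [G = A + E] and generators [a i] of [A], moving each [a i] to [u i] and
    fixing [E] defines a monomorphism into [G / N] as soon as [N] absorbs the
    images of the relations between the [a i] and meets the images only there. *)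
Lemma relocation_embeds (G : zmodType) (I : eqType) (D : pred I) (a u : I -> G)
    (A E N : set G) (hN : subgp N) :
  subgp E -> direct A E ->
  (forall i, D i -> A (a i)) -> A `<=` span [set y | exists2 i, D i & y = a i] ->
  subgp A ->
  (forall s, supported D s -> comb a s = 0 -> N (comb u s)) ->
  (forall s e, supported D s -> E e -> N (comb u s + e) -> comb a s = 0 /\ e = 0) ->
  embeds_in_quotient (pack hN).
Proof.
move=> hE [AE0 AEs] Aa Agen hA absorb meet.
apply: (@graph_embeds _ _ (fun x y => exists s e n,
  [/\ supported D s, E e, N n & x = comb a s + e /\ y = comb u s + e + n])).
have E0 : E 0 by case: hE.
have N0 : N 0 by case: hN.
split.
- move=> x; have [y [e [Ay Ee ->]]] := AEs x.
  have /span_comb [s sD ->] := Agen _ Ay.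
  by exists (comb u s + e + 0), s, e, 0.
- move=> _ _ _ _ [s [e [n [sD Ee Nn [-> ->]]]]] [t [f [k [tD Ef Nk [-> ->]]]]].
  exists (s ++ oppc t), (e - f), (n - k); split.
  + exact: supported_subc.
  + exact: subgpB.
  + exact: subgpB.
  + have sumB (b c b' c' : G) : b + c - (b' + c') = b - b' + (c - c').
      by rewrite opprD addrACA.
    by rewrite !comb_subc !sumB.
- move=> _ _ [s [e [n [sD Ee Nn [-> ->]]]]]; split.
    move=> se0; have As : A (comb a s) by exact: comb_in sD.
    have s0 : comb a s = 0.
      apply: AE0 => //; rewrite -[comb a s](addrK e) se0 sub0r; exact: subgpN.
    have e0 : e = 0 by move: se0; rewrite s0 add0r.
    by apply/packP; rewrite e0 addr0; apply: subgpD => //; exact: absorb.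
  move=> /packP Nsen; have Nse : N (comb u s + e).
    by rewrite -[_ + e](addrK n); exact: subgpB.
  by have [-> ->] := meet _ _ sD Ee Nse; rewrite addr0.
- move=> y /packP Ny; exists [::], 0, y; rewrite !comb_nil !addr0 add0r.
  by split.
Qed.

(** * Groups with primary projections *)

(** The intrinsic form of the pure subgroups of products: [pi p] projects onto
    the [p]-primary component, which has exponent [p ^ k p], along a subgroup
    of elements divisible by that exponent, and the projections separate
    points. *)
Definition primary_projections (G : zmodType) (k : nat -> nat)
    (pi : nat -> {additive G -> G}) : Prop :=
  [/\ forall p, prime p -> (0 < k p)%N,
      forall p x, prime p -> pi p x *+ (p ^ k p) = 0,
      forall p n x, prime p -> x *+ (p ^ n) = 0 -> pi p x = x,
      forall p x, prime p -> exists z, x - pi p x = z *+ (p ^ k p)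
    & forall x, (forall p, prime p -> pi p x = 0) -> x = 0].

Section PrimaryProjections.
Variables (G : zmodType) (k : nat -> nat) (pi : nat -> {additive G -> G}).
Hypothesis hpi : primary_projections k pi.
Implicit Types (p q n m : nat) (x y : G) (S A E N : set G).

Lemma expo_gt0 p : prime p -> (0 < k p)%N.
Proof. by case: hpi => + _ _ _ _; apply. Qed.

Lemma pi_exp p x : prime p -> pi p x *+ (p ^ k p) = 0.
Proof. by case: hpi => _ + _ _ _; apply. Qed.

Lemma pi_id p n x : prime p -> x *+ (p ^ n) = 0 -> pi p x = x.
Proof. by case: hpi => _ _ + _ _; apply. Qed.

Lemma pi_div p x : prime p -> exists z, x - pi p x = z *+ (p ^ k p).
Proof. by case: hpi => _ _ _ + _; apply. Qed.

Lemma pi_separate x : (forall p, prime p -> pi p x = 0) -> x = 0.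
Proof. by case: hpi => _ _ _ _; apply. Qed.

Definition prim p : set G := [set x | pi p x = x].

Lemma subgp_prim p : subgp (prim p).
Proof.
by split=> [|x y]; rewrite /prim /= ?raddf0 // raddfB => -> ->.
Qed.

Lemma pi_idem p x : prime p -> pi p (pi p x) = pi p x.
Proof. by move=> pp; apply: (pi_id pp (pi_exp x pp)). Qed.

Lemma prim_pi p x : prime p -> prim p (pi p x).
Proof. exact: pi_idem. Qed.

Lemma prim_exp p x : prime p -> prim p x -> x *+ (p ^ k p) = 0.
Proof. by move=> pp <-; exact: pi_exp. Qed.

Lemma pi_ann p x : prime p -> pi p (x *+ (p ^ k p)) = 0.
Proof. by move=> pp; rewrite raddfMn pi_exp. Qed.

Lemma pi_torsion0 p n x : prime p -> ~~ (p %| n)%N -> x *+ n = 0 -> pi p x = 0.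
Proof.
move=> pp npn xn; apply: (@coprime_order _ _ (p ^ k p) n).
- by rewrite coprimeXl // prime_coprime.
- exact: pi_exp.
- by rewrite -raddfMn xn raddf0.
Qed.

Lemma prim_neq p q x : prime p -> prime q -> p != q -> prim p x -> pi q x = 0.
Proof.
move=> pp pq npq px; apply: (pi_torsion0 pq _ (prim_exp pp px)).
apply: contra npq => h; have : (q %| p)%N by move: h; rewrite Euclid_dvdX // => /andP[].
by rewrite dvdn_prime2 // eq_sym.
Qed.

(** Full invariance: an endomorphism respects orders and divisibility, which
    characterize the two parts of [x = pi p x + (x - pi p x)]. *)
Lemma pi_natural (f : {additive G -> G}) p x : prime p -> f (pi p x) = pi p (f x).
Proof.
move=> pp; have [z hz] := pi_div x pp.
have -> : f x = f (pi p x) + f z *+ (p ^ k p).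
  by rewrite -raddfMn -hz -raddfD addrC subrK.
rewrite raddfD pi_ann // addr0; apply/esym; apply: (@pi_id p (k p)) => //.
by rewrite -raddfMn pi_exp // raddf0.
Qed.

Lemma sum_pi (l : seq nat) q (F : nat -> G) : uniq l -> all prime l -> prime q ->
  (forall p, prime p -> prim p (F p)) ->
  pi q (\sum_(p <- l) F p) = if q \in l then F q else 0.
Proof.
move=> ul /allP lp pq hF; rewrite raddf_sum; case: ifPn => ql.
  rewrite (bigD1_seq q) //= hF // big_seq_cond big1 ?addr0 //.
  by move=> p /andP[/lp pp npq]; apply: (prim_neq pp) => //; exact: hF.
rewrite big_seq big1 // => p pl; have pp := lp _ pl.
apply: (prim_neq pp) => //; last exact: hF.
by apply: contraNneq ql => <-.
Qed.

Lemma torsion_sum n x : (0 < n)%N -> x *+ n = 0 ->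
  x = \sum_(p <- primes n) pi p x.
Proof.
move=> n0 xn; apply/eqP; rewrite -subr_eq0; apply/eqP; apply: pi_separate => q pq.
rewrite raddfB sum_pi ?primes_uniq //; last by move=> p pp; exact: prim_pi.
  case: ifPn => [_|]; first by rewrite subrr.
  rewrite mem_primes pq n0 /= => nd; by rewrite (pi_torsion0 pq nd xn) subr0.
by apply/allP => p; rewrite mem_primes => /andP[].
Qed.

Lemma torsion_in S x : subgp S -> torsion_elt x ->
  (forall p, prime p -> S (pi p x)) -> S x.
Proof.
move=> hS [n n0 xn] h; rewrite (torsion_sum n0 xn) big_seq.
by apply: subgp_sum => // p; rewrite mem_primes => /andP[pp _]; exact: h.
Qed.

(** The [p]-component of a torsion element is an integral multiple of it, by
    the Chinese remainder theorem. *)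
Lemma pi_torsion_mem N p x : prime p -> subgp N -> torsion_elt x -> N x -> N (pi p x).
Proof.
move=> pp hN [n n0 xn] Nx; pose m := (n`_p^')%N.
have co : coprime (p ^ k p) m.
  by rewrite coprimeXl // prime_coprime // -p'natE // part_pnat.
have m0 : (0 < m)%N by exact: part_gt0.
have k0 : (0 < p ^ k p)%N by rewrite expn_gt0 prime_gt0.
pose c := chinese (p ^ k p) m 1 0.
suff -> : pi p x = x *+ c by exact: subgpMn.
apply/eqP; rewrite -subr_eq0; apply/eqP; apply: pi_separate => q pq.
rewrite raddfB raddfMn; have [->|nqp] := eqVneq q p.
  rewrite pi_idem //; apply/eqP; rewrite subr_eq0; apply/eqP.
  have := chinese_modl co 1 0; rewrite -/c => e.
  have modk y j : y *+ (p ^ k p) = 0 -> y *+ (j %% p ^ k p) = y *+ j.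
    move=> y0; rewrite [in RHS](divn_eq j (p ^ k p)) mulrnDr.
    by rewrite mulnC mulrnA y0 mul0rn add0r.
  by rewrite -(modk _ c (pi_exp x pp)) e modk ?mulr1n // pi_exp.
rewrite (prim_neq pp pq _ (prim_pi x pp)) 1?eq_sym // sub0r.
suff h : pi q x *+ m = 0.
  have mc : (m %| c)%N by rewrite /dvdn chinese_modr // mod0n.
  by rewrite -(divnK mc) mulnC mulrnA h mul0rn oppr0.
apply: (@coprime_order _ _ (q ^ k q) (n`_p)%N).
- rewrite coprimeXl // prime_coprime // -p'natE //.
  by apply: sub_in_pnat (part_pnat p n) => r _; rewrite !inE => /eqP ->; rewrite eq_sym.
- by rewrite -mulrnA mulnC mulrnA pi_exp // mul0rn.
- rewrite -mulrnA mulnC partnC // -raddfMn xn raddf0 //.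
Qed.

Lemma torsion_saturated N p v : prime p -> subgp N -> torsion_elt v ->
  pi p v = 0 -> N (v *+ (p ^ k p)) -> N v.
Proof.
move=> pp hN tv pv0 Nv.
have tpv : torsion_elt (v *+ (p ^ k p)) by apply: subgpMn => //; exact: subgp_torsion.
apply: torsion_in => // q pq.
have [->|nqp] := eqVneq q p; first by rewrite pv0; case: hN.
apply: (@coprime_subgp _ _ _ (q ^ k q) (p ^ k p)) => //.
- by rewrite coprimeXl // coprimeXr // prime_coprime // dvdn_prime2.
- by rewrite pi_exp //; case: hN.
- by rewrite -raddfMn; exact: pi_torsion_mem.
Qed.

(** Modulo torsion the group is divisible, one prime factor at a time. *)
Lemma torsion_divisible n x : (0 < n)%N -> exists z, torsion_elt (x - z *+ n).
Proof.
elim/ltn_ind: n x => n IHn x n0; have [n1|n1] := leqP n 1.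
  have -> : n = 1%N by apply/eqP; rewrite eqn_leq n1.
  by exists x; rewrite subrr; exists 1%N.
pose p := pdiv n; have pp : prime p by exact: pdiv_prime.
have pn : (p %| n)%N by exact: pdiv_dvd.
have [z hz] := pi_div x pp.
pose y := z *+ (p ^ (k p).-1).
have [w tw] := IHn (n %/ p)%N (ltn_Pdiv (prime_gt1 pp) n0) y
  (eq_ind_r is_true (dvdn_leq n0 pn) (divn_gt0 n (prime_gt0 pp))).
exists w; have -> : x - w *+ n = pi p x + (y - w *+ (n %/ p)) *+ p.
  rewrite mulrnBl -!mulrnA divnK // -expnSr prednK ?expo_gt0 // -hz.
  by rewrite addrA [pi p x + _]addrC subrK.
apply: subgpD; [exact: subgp_torsion| |by apply: subgpMn => //; exact: subgp_torsion].
by exists (p ^ k p)%N; [rewrite expn_gt0 prime_gt0|exact: pi_exp].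
Qed.


(** Componentwise decompositions glue to a decomposition of the group as soon as
    each element has almost all its components in the first parts: the
    finitely many exceptional components of the second kind can be
    subtracted. *)
Lemma assemble (A E : nat -> set G) :
  (forall p, prime p -> [/\ subgp (A p), subgp (E p), A p `<=` prim p & E p `<=` prim p]) ->
  (forall p x, prime p -> A p x -> E p x -> x = 0) ->
  (forall p, prime p -> prim p `<=` sumset (A p) (E p)) ->
  (forall x, exists2 m, (0 < m)%N & forall p, prime p -> ~~ (p %| m)%N -> A p (pi p x)) ->
  let A' := [set x | forall p, prime p -> A p (pi p x)] in
  let E' := [set x | torsion_elt x /\ forall p, prime p -> E p (pi p x)] in
  [/\ subgp A', subgp E' & direct A' E'].
Proof.
move=> hAE AE0 AEs almost A' E'; split.
- split=> [p pp|x y Ax Ay p pp]; have [hA _ _ _] := hAE _ pp.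
    by rewrite raddf0; case: hA.
  by rewrite raddfB; apply: subgpB; [|exact: Ax|exact: Ay].
- split.
    split; first by case: (subgp_torsion G).
    by move=> p pp; have [_ [E0 _] _ _] := hAE _ pp; rewrite raddf0.
  move=> x y [tx Ex] [ty Ey]; split.
    by apply: subgpB => //; exact: subgp_torsion.
  move=> p pp; have [_ hE _ _] := hAE _ pp.
  by rewrite raddfB; apply: subgpB; [|exact: Ex|exact: Ey].
split=> [x Ax [_ Ex]|x].
  by apply: pi_separate => p pp; apply: (AE0 p); [|exact: Ax|exact: Ex].
have [m m0 hm] := almost x.
pose e p := xget 0 [set y | E p y /\ A p (pi p x - y)].
have eP p : prime p -> E p (e p) /\ A p (pi p x - e p).
  move=> pp; have [a [b [Aa Eb eab]]] := AEs p pp _ (prim_pi x pp).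
  apply: (@xgetPex _ 0 [set y | E p y /\ A p (pi p x - y)]); exists b.
  by split=> //; rewrite eab addrK.
have pe p : prime p -> prim p (e p).
  by move=> pp; have [_ _ _ sE] := hAE p pp; apply: sE; case: (eP p pp).
have lp : all prime (primes m) by apply/allP => p; rewrite mem_primes => /andP[].
pose y := \sum_(p <- primes m) e p.
have piy q : prime q -> pi q y = if q \in primes m then e q else 0.
  by move=> pq; apply: sum_pi => //; exact: primes_uniq.
exists (x - y), y; split; last by rewrite subrK.
  move=> q pq; rewrite raddfB piy //; case: ifPn => [_|]; first by case: (eP q pq).
  by rewrite mem_primes pq m0 subr0 /=; exact: hm.
split; last first.
  move=> q pq; rewrite piy //; case: ifPn => _; first by case: (eP q pq).
  by have [_ [] ] := hAE _ pq.
rewrite /y big_seq; apply: subgp_sum => [|p]; first exact: subgp_torsion.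
rewrite mem_primes => /andP[pp _].
exists (p ^ k p)%N; first by rewrite expn_gt0 prime_gt0.
exact: prim_exp (pe p pp).
Qed.

Definition finite_sub S : Prop := exists l : seq G, forall x, S x -> x \in l.

Lemma finite_span (l : seq G) n : (0 < n)%N -> (forall x, x \in l -> x *+ n = 0) ->
  finite_sub (span [set x | x \in l]).
Proof.
move=> n0; elim: l => [|x l IHl] hl.
  exists [:: 0] => y h; rewrite inE; apply/eqP.
  by apply: (h [set 0]) => //; exact: subgp0.
have [|L hL] := IHl; first by move=> y yl; apply: hl; rewrite inE yl orbT.
exists [seq x *+ a + y | a <- iota 0 n, y <- L] => z hz.
have [a [y [sy ->]]] : exists a y, span [set x | x \in l] y /\ z = x *+ a + y.
  apply: (hz [set z | exists a y, span [set x | x \in l] y /\ z = x *+ a + y]).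
    split; first by exists 0%N, 0; rewrite addr0; split=> //; case: (subgp_span [set x | x \in l]).
    move=> _ _ [a [y [sy ->]]] [b [w [sw ->]]].
    exists (a + (n - b %% n))%N, (y - w); split.
      exact: (subgpB (subgp_span _) sy sw).
    have bn : x *+ (b %% n) = x *+ b.
      rewrite [in RHS](divn_eq b n) mulrnDr mulnC mulrnA.
      by rewrite hl ?inE ?eqxx // mul0rn add0r.
    rewrite mulrnDr mulrnBr ?(ltnW (ltn_pmod _ _)) // hl ?inE ?eqxx // sub0r bn.
    by rewrite opprD addrACA.
  move=> w /=; rewrite inE => /orP[/eqP ->|wl].
    by exists 1%N, 0; rewrite addr0; split=> //; case: (subgp_span [set x | x \in l]).
  by exists 0%N, w; rewrite add0r; split=> //; exact: sub_span.
apply/allpairsP; exists ((a %% n)%N, y); split; [|exact: hL|].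
  by rewrite mem_iota /= ltn_pmod.
rewrite /= [in LHS](divn_eq a n) mulrnDr mulnC mulrnA.
by rewrite hl ?inE ?eqxx // mul0rn add0r.
Qed.

Lemma finite_sumset A B : finite_sub A -> finite_sub B -> finite_sub (sumset A B).
Proof.
move=> [l hl] [m hm]; exists [seq a + b | a <- l, b <- m] => _ [a [b [Aa Bb ->]]].
by apply/allpairsP; exists (a, b); split; [exact: hl|exact: hm|].
Qed.

(** If [p] times the [p]-component is finite, the component is elementary up to
    a finite summand, which can be chosen around any given [V]: add to [V]
    finitely many elements that lift the multiples of [p], and split off the
    rest of the [p]-socle. *)
Lemma elementary_complement p V : prime p -> subgp V -> V `<=` prim p ->
  finite_sub [set x | exists2 y, prim p y & x = y *+ p] ->
  exists (l : seq G) (E : set G),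
    let A := sumset V (span [set x | x \in l]) in
    [/\ forall x, x \in l -> prim p x,
        subgp E /\ E `<=` prim p,
        forall x, E x -> x *+ p = 0,
        forall x, A x -> E x -> x = 0
      & prim p `<=` sumset A E].
Proof.
move=> pp hV Vp [L hL].
pose lift y := xget 0 [set x | prim p x /\ x *+ p = y].
have lP y : prim p (lift y).
  rewrite /lift; case: xgetP => [x _ [] //|_].
  by case: (subgp_prim p).
exists (map lift L).
set F := span _; set A := sumset V F.
have hF : subgp F by exact: subgp_span.
have hA : subgp A by exact: subgp_sumset.
pose S := [set x | prim p x /\ x *+ p = 0].
have hS : subgp S.
  split; first by split; [case: (subgp_prim p)|rewrite mul0rn].
  move=> x y [px x0] [py y0]; split; first by apply: subgpB => //; exact: subgp_prim.
  by rewrite mulrnBl x0 y0 subrr.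
have S0 : [set 0] `<=` S by move=> _ ->; case: hS.
have [|E [hE _ ES AE0 AEs]] := disjoint_maximal hA (@subgp0 G) hS S0; first by [].
exists E; split=> //.
- by move=> _ /mapP [y _ ->].
- by split=> // x /ES [].
- by move=> x /ES [].
- move=> x px; pose y := lift (x *+ p).
  have [py yp] : prim p y /\ y *+ p = x *+ p.
    by apply: (@xgetPex _ 0 [set z | prim p z /\ z *+ p = x *+ p]); exists x.
  have Ay : A y.
    apply: sumsetr => //; apply: sub_span; apply: map_f; apply: hL; by exists x.
  have hAE : subgp (sumset A E) by exact: subgp_sumset.
  rewrite -[x](subrK y) addrC; apply: subgpD => //; first exact: sumsetl.
  have xy0 : (x - y) *+ p = 0 by rewrite mulrnBl yp subrr.
  apply: (AEs p) => //; last by rewrite xy0; case: hE.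
  by split=> //; apply: subgpB => //; exact: subgp_prim.
Qed.


(** * Generalized Bassian groups: the multiples of p in each component *)

Lemma gB_summand N (hN : subgp N) : generalized_Bassian G ->
  embeds_in_quotient (pack hN) -> exists2 K, subgp K & direct N K.
Proof.
move=> gB /gB [K [NK0 NKs]]; exists [set x | x \in K]; first exact: subgp_mem.
split=> [x Nx Kx|x]; first by apply: NK0 => //; apply/packP.
by have [a [b [/packP Na Kb ->]]] := NKs x; exists a, b.
Qed.

Definition multiples p j : set G := [set x | exists2 y, prim p y & x = y *+ (p ^ j)].

Section MultiplesStep.
Variables (p j : nat).
Hypotheses (pp : prime p) (j_gt0 : (0 < j)%N).
Hypothesis fin : finite_sub (multiples p j.+1).
Hypothesis inf : ~ finite_sub (multiples p j).

Let n := (p ^ j.+1)%N.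
Let Y : set G := [set x | exists z, x = z *+ n].
Let good : set G := [set x | prim p x /\ x *+ n = 0].

Let hY : subgp Y.
Proof.
split; first by exists 0; rewrite mul0rn.
by move=> _ _ [z ->] [w ->]; exists (z - w); rewrite mulrnBl.
Qed.

Let goodp x : good x -> x *+ (p ^ j) *+ p = 0.
Proof. by move=> [_ xn]; rewrite -mulrnA -expnSr. Qed.

(** Otherwise all [p ^ j]-th multiples of elements of exponent [p ^ j.+1] would lie
    in a finite subgroup, and every other element of the component differs
    from one of these by one of finitely many. *)
Let extend (l : seq G) : exists x, (forall y, y \in l -> good y) ->
  good x /\ forall d (c : nat -> int),
    Y (x *+ (p ^ j) *~ d + \sum_(i < size l) (l`_i *+ (p ^ j)) *~ c i) -> (p%:Z %| d)%Z.
Proof.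
apply: contrapT => no; apply: inf.
have lgood y : y \in l -> good y.
  apply: contrapT => h; apply: no; exists 0 => h'; exfalso; apply: h => yl.
  exact: h'.
pose W := span [set x | x \in [seq y *+ (p ^ j) | y <- l]].
have hW : subgp W by exact: subgp_span.
have hH : subgp (sumset Y W) by exact: subgp_sumset.
have Wp : W `<=` prim p.
  apply: span_min; first exact: subgp_prim.
  move=> _ /mapP [y /lgood [py _] ->]; exact: (subgpMn _ (subgp_prim p) py).
have finH : finite_sub (sumset (multiples p j.+1) W).
  apply: finite_sumset => //; apply: (finite_span (prime_gt0 pp)).
  by move=> _ /mapP [y /lgood /goodp h ->].
have inH x : good x -> sumset Y W (x *+ (p ^ j)).
  move=> gx; apply: contrapT => nH; apply: no; exists x => _; split=> // d c Yx.
  apply: contrapT => /negP npd; apply: nH.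
  apply: (prime_subgpz hH pp (c := d)); first exact/negP.
    by rewrite goodp //; case: hH.
  rewrite -[X in sumset _ _ X](addrK (\sum_(i < size l) (l`_i *+ (p ^ j)) *~ c i)).
  apply: subgpB => //; first exact: sumsetl.
  apply: sumsetr => //; apply: (@subgp_sum _ W _ _ _ _ hW) => i _; apply: (@subgpMz _ W _ _ hW).
  by apply: sub_span; apply/mapP; exists l`_i => //; exact: mem_nth.
have [LH hLH] := finH; have [M hM] := fin.
pose t y := xget 0 [set x | prim p x /\ x *+ n = y].
exists [seq t y *+ (p ^ j) + h | y <- M, h <- LH] => _ [y py ->].
have [pt tn] : prim p (t (y *+ n)) /\ t (y *+ n) *+ n = y *+ n.
  by apply: (@xgetPex _ 0 [set x | prim p x /\ x *+ n = y *+ n]); exists y.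
have gy : good (y - t (y *+ n)).
  by split; [exact: (subgpB (subgp_prim p) py pt)|rewrite mulrnBl tn subrr].
apply/allpairsP; exists (y *+ n, (y - t (y *+ n)) *+ (p ^ j)); split.
- by apply: hM; exists y.
- apply: hLH; have [_ [w [[z ->] Ww e]]] := inH _ gy.
  exists (z *+ n), w; split=> //; exists (pi p z); first exact: prim_pi.
  have -> : z *+ n = (y - t (y *+ n)) *+ (p ^ j) - w by rewrite e addrK.
  rewrite -raddfMn -/n; have -> : z *+ n = (y - t (y *+ n)) *+ (p ^ j) - w.
    by rewrite e addrK.
  apply/esym; apply: (subgpB (subgp_prim p)); last exact: Wp.
  by apply: (subgpMn _ (subgp_prim p)); case: gy.
- by rewrite -mulrnDl addrC subrK.
Qed.

Let sequence : exists x : nat -> G, (forall i, good (x i)) /\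
  forall m d (c : nat -> int),
    Y (x m *+ (p ^ j) *~ d + \sum_(i < m) (x i *+ (p ^ j)) *~ c i) -> (p%:Z %| d)%Z.
Proof.
have [x hx] := sequence_of_extensions extend; exists x.
have gx i : good (x i).
  elim/ltn_ind: i => i IHi; have [|//] := hx i.
  by move=> _ /mapP [m mi ->]; apply: IHi; rewrite mem_iota in mi.
split=> // m d c hY'; have [|_ /(_ d c)] := hx m.
  by move=> _ /mapP [i _ ->].
apply; rewrite size_mkseq.
by under eq_bigr => i _ do rewrite nth_mkseq //.
Qed.

(** The elements [x i] span a direct sum of cyclic groups of order [n], which is
    a summand because it avoids the multiples of [n]. Shifting the generators by
    one leaves room for the nonzero element [x 0 *+ p ^ j], so [G] embeds in
    its quotient by it; but an element of order [p] that is divisible by [p]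
    never spans a summand. *)
Lemma multiples_step : ~ generalized_Bassian G.
Proof.
have [x [gx tri]] := sequence => gB.
pose s i := x i *+ (p ^ j).
have xn i : x i *+ n = 0 by case: (gx i).
have sp i : s i *+ p = 0 by exact: goodp.
have Y0 : Y 0 by case: hY.
have indep_s m (c : nat -> int) : Y (\sum_(i < m) s i *~ c i) ->
    forall i, (i < m)%N -> (p%:Z %| c i)%Z.
  by apply: triangular_indep => // i; rewrite sp.
have indep_x m (c : nat -> int) : Y (\sum_(i < m) x i *~ c i) ->
    forall t, (t <= j.+1)%N -> forall i, (i < m)%N -> ((p ^ t)%:Z %| c i)%Z.
  move=> Yx; elim=> [|t IHt] tj i im; first by rewrite dvd1z.
  pose d i := (c i %/ (p ^ t)%:Z)%Z.
  have cd l : (l < m)%N -> c l = d l * (p ^ t)%:Z.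
    by move=> lm; rewrite divzK //; apply: IHt => //; exact: ltnW.
  have Ys : Y (\sum_(i < m) s i *~ d i).
    have -> : \sum_(i < m) s i *~ d i = (\sum_(i < m) x i *~ c i) *+ (p ^ (j - t)).
      rewrite -sumrMnl; apply: eq_bigr => l _; rewrite cd // /s !pmulrn -!mulrzA.
      congr (_ *~ _); rewrite -mulrA -PoszM -expnD subnKC //; first exact: mulrC.
    exact: subgpMn.
  rewrite cd // expnSr PoszM mulrC; apply: dvdz_mul => //.
  exact: (indep_s m).
have indep_comb sg : Y (comb x sg) -> forall i, (n%:Z %| coef sg i)%Z.
  have [m -> c0] := comb_nat x sg => Yx i.
  by have [im|/c0 ->] := ltnP i m; [exact: (indep_x m)|exact: dvdz0].
pose X := span [set y | exists2 i, predT i & y = x i].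
have hX : subgp X by exact: subgp_span.
have XP y : X y -> exists sg, y = comb x sg.
  by move=> /span_comb [sg _ ->]; exists sg.
have Xx i : X (x i) by apply: sub_span; exists i.
have XY y : X y -> Y y -> y = 0.
  by move=> /XP [sg ->] /indep_comb h; exact: comb_transfer h xn.
have Xspan : X `<=` span [set y | exists2 i, predT i & y = x i] by [].
clearbody X.
have hT : subgp [set: G] by [].
have YT : Y `<=` [set: G] by [].
have [K [hK YK _ XK0 XKs]] := disjoint_maximal hX hY hT YT XY.
have hXK : subgp (sumset X K) by exact: subgp_sumset.
have step y : sumset X K (y *+ p) -> sumset X K y.
  move=> [xi [ka [Xxi Kka e]]]; have [sg xisg] := XP _ Xxi.
  have xi0 : xi *+ (p ^ j) = 0.
    apply: XK0; first exact: subgpMn.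
    have -> : xi = y *+ p - ka by rewrite e addrK.
    rewrite mulrnBl -mulrnA -expnS; apply: subgpB => //; last exact: subgpMn.
    by apply: YK; exists y.
  have [m xiE _] := comb_nat x sg.
  have Ys : Y (\sum_(i < m) s i *~ coef sg i).
    have -> : \sum_(i < m) s i *~ coef sg i = xi *+ (p ^ j); last by rewrite xi0.
    rewrite xisg xiE -sumrMnl; apply: eq_bigr => i _.
    by rewrite /s !pmulrn -!mulrzA mulrC.
  have [xi' Xxi' xip] : exists2 xi', X xi' & xi = xi' *+ p.
    exists (\sum_(i < m) x i *~ (coef sg i %/ p)%Z).
      by apply: (@subgp_sum _ X _ _ _ _ hX) => i _; exact: (@subgpMz _ X _ _ hX).
    rewrite xisg xiE -sumrMnl; apply: eq_bigr => i _.
    by rewrite !pmulrn -!mulrzA divzK //; exact: (indep_s m).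
  rewrite -[y](subrK xi'); apply: subgpD => //; last exact: sumsetl.
  by apply: (XKs p) => //; rewrite mulrnBl e xip addrAC subrr add0r.
have XKT y : sumset X K y.
  have: sumset X K (y *+ n) by apply: sumsetr => //; apply: YK; exists y.
  rewrite /n; elim: (j.+1) y => [//|t IHt] y.
  by rewrite expnS mulrnA => /IHt /step.
pose N := span [set s 0%N].
have hN : subgp N by exact: subgp_span.
have NP y : N y -> exists c, y = s 0%N *~ c by exact: span1.
have NX : N `<=` X.
  by apply: (span_min hX) => _ ->; exact: (subgpMn _ hX (Xx _)).
have Ns : N (s 0%N) by exact: sub_span.
clearbody N.
have emb : embeds_in_quotient (pack hN).
  apply: (relocation_embeds (D := predT) (a := x) (u := fun i => x i.+1)
    (A := X) (E := K)) => //.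
  - move=> sg _ sg0; have -> : comb (fun i => x i.+1) sg = 0; last by case: hN.
    apply: (@comb_transfer _ _ n) => //; apply: indep_comb; by rewrite sg0.
  - move=> sg e _ Ke Nse.
    have Xu : X (comb (fun i => x i.+1) sg).
      by apply: (comb_in (D := predT)) => //; apply/allP.
    have e0 : e = 0.
      apply: XK0 => //; rewrite -[e](addKr (comb (fun i => x i.+1) sg)).
      by apply: subgpD => //; [exact: subgpN|exact: NX].
    split=> //; have [c hc] := NP _ Nse; move: hc; rewrite e0 addr0 => hc.
    pose ta := [seq (q.1.+1, q.2) | q : nat * int <- sg] ++ [:: (0%N, - ((p ^ j)%:Z * c))].
    have ta0 : comb x ta = 0.
      rewrite comb_cat /comb big_map big_seq1 /=.
      rewrite -[X in X + _]/(comb (fun i => x i.+1) sg) hc.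
      by rewrite /s pmulrn -mulrzA mulrNz subrr.
    apply: (@comb_transfer _ _ n) => // i.
    have -> : coef sg i = coef ta i.+1.
      by rewrite /coef big_cat big_map /= big_cons big_nil /= addr0.
    by apply: indep_comb; rewrite ta0.
have [K' hK' [NK0 NKs]] := gB_summand gB emb.
have [a [b [Na Kb ab]]] := NKs (x 0%N *+ (p ^ j.-1)).
have sE : s 0%N = a *+ p + b *+ p.
  by rewrite -mulrnDl -ab -mulrnA -expnSr prednK.
have b0 : b *+ p = 0.
  apply: NK0; last exact: subgpMn.
  have -> : b *+ p = s 0%N - a *+ p by rewrite sE addrAC subrr add0r.
  by apply: subgpB => //; exact: subgpMn.
have [c ac] := NP _ Na.
have s0 : s 0%N = 0.
  rewrite sE b0 addr0 ac pmulrn -mulrzA mulrC mulrzA -pmulrn sp.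
  exact: mul0rz.
have := indep_s 1%N (fun=> 1); rewrite big_ord1 s0 mul0rz => /(_ Y0 0%N isT).
by rewrite dvdz1 /=; move: (prime_gt1 pp); case: (p) => [|[]].
Qed.

End MultiplesStep.

Lemma gB_finite_multiples p : generalized_Bassian G -> prime p ->
  finite_sub (multiples p 1).
Proof.
move=> gB pp; apply: contrapT => inf1.
have fink : finite_sub (multiples p (k p)).
  exists [:: 0] => _ [y py ->]; rewrite inE (prim_exp pp py) //.
have : forall i, ~ finite_sub (multiples p i.+1).
  elim=> // i inf fin; exact: (@multiples_step p i.+1).
by have := expo_gt0 pp; case: (k p) fink => // i fini _ /(_ i).
Qed.


End PrimaryProjections.

Section SubgroupVal.
Variables (G : zmodType) (A : zmodClosed G).
Implicit Types x y : subgroup A.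

Lemma subgroup_valB x y : val (x - y) = val x - val y.
Proof. by []. Qed.

Lemma subgroup_valMn x n : val (x *+ n) = val x *+ n.
Proof. exact: raddfMn. Qed.

End SubgroupVal.

Lemma summand_projections (G : zmodType) k (pi : nat -> {additive G -> G})
    (A E : zmodClosed G) : primary_projections k pi -> internal_dirsum A E ->
  exists pi' : nat -> {additive subgroup A -> subgroup A},
    primary_projections k pi' /\
    forall p x, prime p -> val (pi' p x) = pi p (val x).
Proof.
move=> hpi dAE.
have [rho [rhoA rho_id _]] := direct_proj (subgp_mem A) (subgp_mem E) dAE.
have piA p (x : subgroup A) : prime p -> pi p (val x) \in A.
  move=> pp; rewrite -[val x]rho_id; last exact: (valP x).
  rewrite -(pi_natural hpi) //; exact: rhoA.
have h p : exists f : {additive subgroup A -> subgroup A},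
    prime p -> forall x, val (f x) = pi p (val x).
  have [pp|] := boolP (prime p); last by exists idfun.
  pose f x : subgroup A := Subgroup (piA p x pp).
  have fB : {morph f : x y / x - y}.
    by move=> x y; apply: val_inj; rewrite subgroup_valB /= -raddfB.
  by have [g gE] := additive_exists fB; exists g => _ x; rewrite gE.
have [pi' pi'E0] := choice h.
have pi'E p x : prime p -> val (pi' p x) = pi p (val x) by move=> pp; exact: pi'E0.
exists pi'; split=> //; split.
- exact: (expo_gt0 hpi).
- by move=> p x pp; apply: val_inj; rewrite subgroup_valMn pi'E // (pi_exp hpi).
- move=> p n x pp xn; apply: val_inj; rewrite pi'E //.
  by apply: (pi_id hpi pp (n := n)); rewrite -subgroup_valMn xn.
- move=> p x pp; have [z hz] := pi_div hpi (val x) pp.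
  exists (Subgroup (rhoA z)); apply: val_inj.
  rewrite subgroup_valB subgroup_valMn pi'E //= -raddfMn -hz raddfB rho_id; last exact: (valP x).
  by rewrite rho_id //; exact: piA.
- move=> x x0; apply: val_inj; apply: (pi_separate hpi) => p pp.
  by rewrite -pi'E // x0.
Qed.

(** * Finite torsion-free rank *)

Lemma span_seq (G : zmodType) (l : seq G) w : span [set x | x \in l] w ->
  exists c : nat -> int, w = \sum_(i < size l) l`_i *~ c i.
Proof.
pose C := [set w | exists c : nat -> int, w = \sum_(i < size l) l`_i *~ c i].
suff lC : span [set x | x \in l] `<=` C by exact: lC.
apply: span_min.
  split; first by exists (fun=> 0); rewrite big1.
  move=> _ _ [c ->] [d ->]; exists (fun i => c i - d i).
  by rewrite -sumrB; apply: eq_bigr => i _; rewrite mulrzBr.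
move=> x xl; exists (fun i => (i == index x l)%:R).
have il : (index x l < size l)%N by rewrite index_mem.
rewrite (bigD1 (Ordinal il)) //= eqxx nth_index // big1 ?addr0 // => i.
by rewrite -val_eqE /= => /negbTE ->.
Qed.

(** The rows of an integer matrix with more rows than columns are dependent:
    clear the denominators of a rational vector in the kernel. *)
Lemma int_kernel r (c : nat -> nat -> int) :
  exists d : nat -> int, (exists2 i, (i < r.+1)%N & d i != 0) /\
  forall j, (j < r)%N -> \sum_(i < r.+1) d i * c i j = 0.
Proof.
pose M : 'M[rat]_(r.+1, r) := \matrix_(i, j) (c i j)%:~R.
have kM : kermx M != 0.
  rewrite kermx_eq0 /row_free neq_ltn; apply/orP; left.
  by rewrite ltnS rank_leq_col.
have [i0 vi0] : exists i, row i (kermx M) != 0.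
  by apply/existsP; apply: contraNT kM => /existsPn h; apply/eqP/row_matrixP => i;
    rewrite row0; apply/eqP; have := h i; rewrite negbK.
pose v := row i0 (kermx M).
have vM : v *m M = 0 by rewrite -row_mul mulmx_ker row0.
have [j0 vj0] : exists j, v 0 j != 0.
  by apply/existsP; apply: contraNT vi0 => /existsPn h; apply/eqP/rowP => j;
    rewrite [RHS]mxE; apply/eqP; have := h j; rewrite negbK.
pose D : int := \prod_(i < r.+1) denq (v 0 i).
pose d (i : nat) : int := if insub i is Some j
  then numq (v 0 j) * \prod_(t < r.+1 | t != j) denq (v 0 t) else 0.
have dE (i : 'I_r.+1) : (d i)%:~R = v 0 i * D%:~R :> rat.
  have -> : D = denq (v 0 i) * \prod_(t < r.+1 | t != i) denq (v 0 t).
    by rewrite /D (bigD1 i).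
  rewrite /d valK !intrM mulrA; congr (_ * _).
  exact: numqE.
have D0 : (D%:~R : rat) != 0.
  rewrite intr_eq0; apply/prodf_neq0 => i _; exact: denq_neq0.
exists d; split.
  exists j0 => //; rewrite -(intr_eq0 rat) dE mulf_neq0 //.
move=> j jr; apply/eqP; rewrite -(intr_eq0 rat) rmorph_sum /=.
have := congr1 (fun w : 'rV_r => w 0 (Ordinal jr)) vM; rewrite !mxE => e.
rewrite (eq_bigr (fun i : 'I_r.+1 => D%:~R * (v 0 i * M i (Ordinal jr)))).
  by rewrite -mulr_sumr e mulr0.
by move=> i _; rewrite intrM dE [M _ _]mxE mulrA [D%:~R * _]mulrC.
Qed.

Definition finite_rank (G : zmodType) : Prop :=
  exists l : seq G, forall x, exists2 m, (0 < m)%N & span [set y | y \in l] (x *+ m).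

Definition free_family (G : zmodType) r (u : nat -> G) : Prop :=
  forall c : nat -> int, \sum_(i < r) u i *~ c i = 0 ->
  forall i, (i < r)%N -> c i = 0.

Lemma finite_rank_bound (G : zmodType) : finite_rank G ->
  exists r, forall u : nat -> G, ~ free_family r.+1 u.
Proof.
move=> [l hl]; exists (size l) => u free.
have h x : exists mc : nat * (nat -> int),
    (0 < mc.1)%N /\ x *+ mc.1 = \sum_(i < size l) l`_i *~ mc.2 i.
  by have [m m0 /span_seq [c hc]] := hl x; exists (m, c).
have [f fP] := choice h.
have [d [[i0 i0r di0] hd]] := int_kernel (size l) (fun i => (f (u i)).2).
have := free (fun i => (f (u i)).1%:Z * d i); set S := \sum_(i < _) _.
have -> : S = 0.
  rewrite /S (eq_bigr (fun i : 'I_(size l).+1 =>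
    \sum_(j < size l) l`_j *~ (d i * (f (u i)).2 j))); last first.
    move=> i _; rewrite mulrzA -pmulrn (fP (u i)).2 mulrz_suml.
    by apply: eq_bigr => j _; rewrite -mulrzA mulrC.
  rewrite exchange_big /= big1 // => j _.
  by rewrite -mulrz_sumr hd // mulr0z.
move=> /(_ erefl i0 i0r) /eqP; rewrite mulf_eq0 (negbTE di0) orbF.
by have [+ _] := fP (u i0); case: ((f (u i0)).1).
Qed.

(** As [G] embeds in [G / N], the rank of [N] is zero: an element of infinite
    order in [N], together with the images of a maximal independent family,
    would form a larger one. *)
Lemma kernel_torsion (G : zmodType) (N : set G) R : finite_rank G ->
  quotient_graph N R -> forall z, N z -> torsion_elt z.
Proof.
move=> /finite_rank_bound [b hb] hR z Nz.
have [r [u fu] max] : exists2 r, (exists u : nat -> G, free_family r u)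
    & ~ exists u : nat -> G, free_family r.+1 u.
  apply: contrapT => no.
  have all_r : forall r, exists u : nat -> G, free_family r u.
    elim=> [|r IHr]; first by exists (fun=> 0).
    by apply: contrapT => h; apply: no; exists r.
  by have [u /hb] := all_r b.+1.
have [Rt _ R0 _] := hR; have [g hg] := choice Rt.
apply: contrapT => ntz; apply: max.
exists (fun i => if (i < r)%N then g (u i) else z) => c.
rewrite big_ord_recr /= ltnn.
under eq_bigr => i _ do rewrite ltn_ord.
set S := \sum_(i < r) _ => S0.
have RS : R (\sum_(i < r) u i *~ c i) S.
  by apply: (graph_sum hR) => i; apply: (graphMz hR).
have NS : N S.
  have -> : S = 0 - z *~ c r by rewrite -S0 addrK.
  have RN n : N n -> R 0 n by case: hR => _ _ _; apply.
  have [_ RB _ _] := hR.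
  have h : R 0 (z *~ c r) by have := graphMz hR (c r) (RN _ Nz); rewrite mul0rz.
  have := RB _ _ _ _ (graph00 hR) h; rewrite subrr => h'.
  by apply/(R0 _ _ h').
have c0 := fu c ((R0 _ _ RS).2 NS).
move=> i; rewrite ltnS leq_eqVlt => /orP[/eqP ->|]; last exact: c0.
move: S0; rewrite /S big1 ?add0r; last by move=> j _; rewrite c0 // mulr0z.
move=> zc; apply: contrapT => cr0; apply: ntz; exists `|c r|%N.
  by rewrite absz_gt0; apply/eqP.
by move: zc; case: (c r) => m //= /eqP; rewrite oppr_eq0 => /eqP.
Qed.

Section FiniteRank.
Variables (G : zmodType) (k : nat -> nat) (pi : nat -> {additive G -> G}).
Hypothesis hpi : primary_projections k pi.
Implicit Types (p q n m : nat) (x y : G) (S A E N : set G).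

(** The embedding respects the primary projections: as [N] is torsion, [pi p]
    maps it to itself, and the induced map of [G / N] again projects onto the
    [p]-component along a subgroup of elements divisible by its exponent. *)
Lemma graph_pi N R p x y : prime p -> subgp N -> (forall z, N z -> torsion_elt z) ->
  quotient_graph N R -> R x y -> R (pi p x) (pi p y).
Proof.
move=> pp hN Nt hR Rxy; have [Rt RB R0 RN] := hR.
have piN v : N v -> N (pi p v).
  by move=> Nv; apply: (pi_torsion_mem hpi) => //; exact: Nt.
have [z hz] := pi_div hpi x pp.
have [w Rzw] := Rt z; have [u Rxu] := Rt (pi p x).
have Nu : N (u *+ (p ^ k p)).
  have := graphMn hR (p ^ k p) Rxu; rewrite (pi_exp hpi) // => h.
  by apply/(R0 _ _ h).
have Nyu : N (pi p (y - u)).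
  have := RB _ _ _ _ (RB _ _ _ _ Rxy Rxu) (graphMn hR (p ^ k p) Rzw).
  rewrite hz subrr => h; have /piN : N (y - u - w *+ (p ^ k p)) by apply/(R0 _ _ h).
  by rewrite raddfB (pi_ann hpi) // subr0.
have Nuu : N (pi p u - u).
  have tu : torsion_elt u.
    by apply: torsion_eltMn (Nt _ Nu); rewrite expn_gt0 prime_gt0.
  apply: (torsion_saturated hpi pp hN).
  - apply: subgpB => //; first exact: subgp_torsion.
    by apply: (pi_torsion_mem hpi) => //; exact: subgp_torsion.
  - by rewrite raddfB (pi_idem hpi) // subrr.
  - by rewrite mulrnBl (pi_exp hpi) // sub0r; apply: subgpN.
have -> : pi p y = u + ((pi p u - u) + pi p (y - u)).
  by rewrite raddfB addrA [u + _]addrC subrK addrC subrK.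
by apply: (graph_shift hR) => //; exact: subgpD.
Qed.

Lemma finite_components_Bassian : finite_rank G ->
  (forall p, prime p -> finite_sub (prim pi p)) -> Bassian G.
Proof.
move=> frG fin N /embeds_graph [R hR] x Nx.
have hN := subgp_mem N.
have Nt := kernel_torsion frG hR.
apply: (torsion_in hpi (@subgp0 G) (Nt _ Nx)) => p pp.
have [W hW] := fin p pp.
apply: (graph_finite_stable hR (subgp_prim pi p) hW) => //.
- move=> y py; have [/(_ y) [z Ryz] _ _ _] := hR.
  exists (pi p z); first exact: (prim_pi hpi).
  by rewrite -py; apply: (graph_pi pp hN Nt hR).
- exact: (prim_pi hpi).
- by apply: (pi_torsion_mem hpi) => //; exact: Nt.
Qed.

End FiniteRank.

Section FiniteRankDecompositions.
Variables (G : zmodType) (k : nat -> nat) (pi : nat -> {additive G -> G}).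
Hypothesis hpi : primary_projections k pi.

Variable l : seq G.
Hypothesis hl : forall x, exists2 m, (0 < m)%N & span [set y | y \in l] (x *+ m).

Let V p := span [set x | x \in map (pi p) l].

Let hV p : subgp (V p). Proof. exact: subgp_span. Qed.

Let V_prim p : prime p -> V p `<=` prim pi p.
Proof.
move=> pp; apply: span_min; first exact: subgp_prim.
by move=> _ /mapP [y _ ->]; exact: (prim_pi hpi).
Qed.

Let V_finite p : prime p -> finite_sub (V p).
Proof.
move=> pp; apply: (@finite_span _ _ (p ^ k p)); first by rewrite expn_gt0 prime_gt0.
by move=> _ /mapP [y _ ->]; exact: (pi_exp hpi).
Qed.

Let V_almost x m p : span [set y | y \in l] (x *+ m) -> prime p ->
  ~~ (p %| m)%N -> V p (pi p x).
Proof.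
move=> xm pp npm; apply: (coprime_subgp (hV p) (m := m) (n := (p ^ k p)%N)).
- by rewrite coprimeXr // coprime_sym prime_coprime.
- rewrite -raddfMn; apply: (xm [set z | V p (pi p z)]).
    split=> [|z w /= Vz Vw]; first by rewrite /= raddf0; case: (hV p).
    by rewrite raddfB; exact: (subgpB (hV p) Vz Vw).
  by move=> y yl; apply: sub_span; exact: map_f.
- by rewrite (pi_exp hpi) //; case: (hV p).
Qed.


Variable fin : forall p, prime p -> finite_sub (multiples pi p 1).

(** Around the finite subgroups spanned by the components of the finitely many
    elements that carry the rank, split each component into a finite and an
    elementary part. The finite parts assemble to a Bassian summand. *)
Lemma finite_rank_BplusE : BplusE G.
Proof.
have h p : exists AE : set G * set G, prime p -> [/\
    [/\ subgp AE.1, V p `<=` AE.1, AE.1 `<=` prim pi p & finite_sub AE.1],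
    subgp AE.2 /\ AE.2 `<=` prim pi p,
    forall x, AE.2 x -> x *+ p = 0,
    forall x, AE.1 x -> AE.2 x -> x = 0
  & prim pi p `<=` sumset AE.1 AE.2].
  have [pp|] := boolP (prime p); last by exists (set0, set0).
  have [|f [E [fp hE Ep AE0 AEs]]] := elementary_complement pp (hV p) (V_prim pp).
    have [L hL] := fin pp; exists L => _ [y py ->]; apply: hL; by exists y.
  exists (sumset (V p) (span [set x | x \in f]), E) => _; split=> //; split=> /=.
  - by apply: subgp_sumset => //; exact: subgp_span.
  - by apply: sumsetl; exact: subgp_span.
  - move=> _ [a [b [/(V_prim pp) pa sb ->]]]; apply: (subgpD (subgp_prim pi p) pa).
    by apply: (span_min (subgp_prim pi p)) sb.
  - apply: finite_sumset (V_finite pp) _; apply: (@finite_span _ _ (p ^ k p)).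
      by rewrite expn_gt0 prime_gt0.
    by move=> x /fp; exact: (prim_exp hpi).
have [AE hAE] := choice h.
have [||||hA hE dAE] := assemble hpi (A := fun p => (AE p).1) (E := fun p => (AE p).2).
- by move=> p /hAE [[? ? ? ?] [? ?] ? ? ?]; split.
- by move=> p x /hAE [_ _ _ + _]; apply.
- by move=> p /hAE [].
- move=> x; have [m m0 xm] := hl x; exists m => // p pp npm.
  by have [[_ VA _ _] _ _ _ _] := hAE p pp; apply: VA; exact: V_almost xm pp npm.
have intd := internal_pack hA hE dAE.
exists (pack hA), (pack hE); split=> //; last first.
  split=> [x|p pp x [n xn]].
    have /packP [[n n0 xn] _] := valP x; exists n => //.
    by apply: val_inj; rewrite subgroup_valMn xn.
  have /packP [_ /(_ p pp)] := valP x.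
  rewrite (pi_id hpi pp (n := n)); last by rewrite -subgroup_valMn xn.
  have [_ _ Ep _ _] := hAE p pp => /Ep xp.
  by apply: val_inj; rewrite subgroup_valMn xp.
have [pi' [hpi' pi'E]] := summand_projections hpi intd.
have [rho [rhoA rho_id _]] := direct_proj hA hE dAE.
have rhoP x : rho x \in pack hA by apply/packP; exact: rhoA.
pose r x : subgroup (pack hA) := Subgroup (rhoP x).
have rB : {morph r : x y / x - y}.
  by move=> x y; apply: val_inj; rewrite subgroup_valB /= -raddfB.
have [rr rrE] := additive_exists rB.
apply: (finite_components_Bassian hpi').
- exists (map rr l); move=> x; have [m m0 xm] := hl (val x); exists m => //.
  have -> : x *+ m = rr (val x *+ m).
    rewrite raddfMn rrE; congr (_ *+ _); apply: val_inj => /=.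
    by rewrite rho_id //; apply/packP; exact: valP.
  apply: (xm [set z | span [set y | y \in map rr l] (rr z)]).
    have hs := subgp_span [set y | y \in map rr l].
    split=> [|z w /= sz sw]; first by rewrite /= raddf0; case: hs.
    by rewrite raddfB; exact: (subgpB hs sz sw).
  by move=> y yl; apply: sub_span; exact: map_f.
- move=> p pp; have [[_ _ _ [L hL]] _ _ _ _] := hAE p pp.
  exists (map rr L) => x px.
  have /packP /(_ p pp) Ax := valP x.
  have <- : rr (val x) = x.
    by rewrite rrE; apply: val_inj; apply: rho_id; exact/packP/valP.
  apply: map_f; apply: hL.
  by rewrite -pi'E // px in Ax.
Qed.

(** Let [W p] be the finite subgroup spanned by the multiples of [p] in the
    [p]-component and, for almost all [p], by the components of the elements
    that carry the rank. An embedding in [G / N] preserves it, so [N] meets it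
    trivially and the [p]-part of [N] has a complement above [W p]. These
    complements assemble. *)
Lemma finite_rank_gB : generalized_Bassian G.
Proof.
move=> N /embeds_graph [R hR].
have hN := subgp_mem N; set N' := [set x | x \in N] in hR hN.
have frG : finite_rank G by exists l.
have Nt := kernel_torsion frG hR.
have [Rt RB R0 RN] := hR; have [g hg] := choice Rt.
have [M M0 hM] : exists2 M, (0 < M)%N & forall p y, prime p -> ~~ (p %| M)%N ->
    y \in l -> V p (pi p (g y)).
  have : forall s : seq G, exists2 M, (0 < M)%N & forall p y, prime p ->
      ~~ (p %| M)%N -> y \in s -> V p (pi p (g y)).
    elim=> [|a s [M M0 hM]]; first by exists 1%N.
    have [m m0 am] := hl (g a); exists (m * M)%N; first by rewrite muln_gt0 m0.
    move=> p y pp; rewrite Euclid_dvdM // negb_or => /andP[npm npM].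
    rewrite inE => /orP[/eqP ->|]; first exact: V_almost am pp npm.
    exact: hM.
  exact.
pose W p := if (p %| M)%N then multiples pi p 1 else sumset (multiples pi p 1) (V p).
have hm p : subgp (multiples pi p 1).
  have hp := subgp_prim pi p.
  split; first by exists 0; [case: hp|rewrite mul0rn].
  by move=> _ _ [y py ->] [z pz ->]; exists (y - z); [exact: (subgpB hp py pz)|rewrite mulrnBl].
have mp p : multiples pi p 1 `<=` prim pi p.
  by move=> _ [y py ->]; exact: (subgpMn _ (subgp_prim pi p) py).
have hW p : subgp (W p).
  by rewrite /W; case: ifP => _ //; exact: subgp_sumset.
have mW p : multiples pi p 1 `<=` W p.
  by rewrite /W; case: ifP => _ //; exact: sumsetl.
have VW p : ~~ (p %| M)%N -> V p `<=` W p.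
  by rewrite /W => /negbTE ->; exact: sumsetr.
have Wp p : prime p -> W p `<=` prim pi p.
  move=> pp; rewrite /W; case: ifP => _; first exact: mp.
  move=> _ [a [b [/mp pa /(V_prim pp) pb ->]]].
  exact: (subgpD (subgp_prim pi p) pa pb).
have Wfin p : prime p -> finite_sub (W p).
  move=> pp; rewrite /W; case: ifP => _; first exact: fin.
  by apply: finite_sumset; [exact: fin|exact: V_finite].
have Wstable p : prime p -> forall x, W p x -> exists2 y, W p y & R x y.
  move=> pp; have mstable x : multiples pi p 1 x -> exists2 y, multiples pi p 1 y & R x y.
    move=> [y py ->]; have Ry := graph_pi hpi pp hN Nt hR (hg y).
    rewrite py in Ry; exists (pi p (g y) *+ (p ^ 1)); last exact: (graphMn hR).
    by exists (pi p (g y)) => //; exact: (prim_pi hpi).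
  rewrite /W; case: ifPn => // npM _ [a [b [/mstable [a' ma' Ra] Vb ->]]].
  have [b' Vb' Rb] : exists2 b', V p b' & R b b'.
    apply: (Vb [set b | exists2 b', V p b' & R b b']).
      split; first by exists 0; [case: (hV p)|exact: (graph00 hR)].
      move=> x y [x' Vx Rx] [y' Vy Ry]; exists (x' - y'); last exact: RB.
      exact: (subgpB (hV p) Vx Vy).
    move=> _ /mapP [y yl ->]; exists (pi p (g y)); first exact: hM.
    exact: (graph_pi hpi pp hN Nt hR).
  exists (a' + b'); last exact: (graphD hR).
  by exists a', b'.
pose Np p := N' `&` prim pi p.
have hNp p : subgp (Np p) by apply: subgpI => //; exact: subgp_prim.
have h p : exists K, prime p -> [/\ subgp K, W p `<=` K, K `<=` prim pi p,
    forall x, K x -> Np p x -> x = 0 & prim pi p `<=` sumset K (Np p)].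
  have [pp|] := boolP (prime p); last by exists set0.
  have [L hL] := Wfin p pp.
  have disj x : Np p x -> W p x -> x = 0.
    move=> [Nx _] Wx.
    by apply: (graph_finite_stable hR (hW p) hL) => //; exact: Wstable.
  have [K [hK WK Kp NK0 NKs]] := disjoint_maximal (hNp p) (hW p) (subgp_prim pi p)
    (Wp p pp) disj.
  exists K => _; split=> //; first by move=> x Kx Nx; exact: NK0.
  move=> x px; have [|a [b [Na Kb ->]]] := NKs p x pp px.
    by apply: WK; apply: mW; exists x.
  by exists b, a; rewrite addrC.
have [K hK] := choice h.
have [||||hA hE dAE] := assemble hpi (A := K) (E := Np).
- by move=> p /hK [? ? ? ? ?]; split=> // x [].
- by move=> p x /hK [_ _ _ + _]; apply.
- by move=> p /hK [].
- move=> x; have [m m0 xm] := hl x; exists (m * M)%N; first by rewrite muln_gt0 m0.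
  move=> p pp; rewrite Euclid_dvdM // negb_or => /andP[npm npM].
  have [_ WK _ _ _] := hK p pp; apply: WK; apply: (VW p npM).
  exact: V_almost xm pp npm.
exists (pack hA); case: dAE => AE0 AEs; split=> [x Nx /packP Ax|x].
  apply: AE0 => //; split=> [|p pp]; first exact: Nt.
  by split; [apply: (pi_torsion_mem hpi) => //; exact: Nt|exact: (prim_pi hpi)].
have [a [e [Aa [te Ee] ->]]] := AEs x; exists e, a; split; [|exact/packP|exact: addrC].
by apply: (torsion_in hpi hN te) => p pp; case: (Ee p pp).
Qed.

End FiniteRankDecompositions.


(** * Generalized Bassian groups have finite rank *)

Section SequenceFamilies.
Variable G : zmodType.
Implicit Types (J : set (nat -> G)) (l : seq G).

(** Independent families are made of the entries of sequences, not of single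
    elements: the index set [J * nat] absorbs countably many copies of itself
    by an explicit coding of tuples of natural numbers, without any cardinal
    arithmetic. *)
Definition entry (i : (nat -> G) * nat) : G := i.1 i.2.

Definition entries_of J : pred ((nat -> G) * nat) := fun i => `[< J i.1 >].

Definition independent_sequences J : Prop := indep 0 (entries_of J) entry.

Definition entry_set J l : set G :=
  [set y | (exists2 i, entries_of J i & y = entry i) \/ y \in l].

Lemma independent_sequences_bigcup (F : set (set (nat -> G))) :
  F `<=` independent_sequences -> total_on F subset ->
  independent_sequences (\bigcup_(X in F) X).
Proof.
move=> FP Ftot s sF s0 i.
suff [->|[X FX sX]] : s = [::] \/ exists2 X, F X & supported (entries_of X) s.
- by rewrite /coef big_nil dvdz0.
- exact: FP sX s0 i.
elim: s {s0 i} sF => [|q s IHs] /=; first by left.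
case/andP=> /asboolP [X FX Xq] /IHs [->|[Z FZ sZ]]; right.
  by exists X => //; rewrite /= andbT; apply/asboolP.
have [XZ|ZX] := Ftot _ _ FX FZ.
  by exists Z => //=; rewrite sZ andbT; apply/asboolP/XZ.
exists X => //=; apply/andP; split; first exact/asboolP.
by apply: sub_all sZ => r /asboolP h; apply/asboolP/ZX.
Qed.

(** A maximal set of sequences carries the rank up to finitely many elements;
    otherwise the missing elements could be chosen one after the other and
    would form a further sequence. *)
Lemma maximal_sequences : exists J l, independent_sequences J /\
  forall x, exists2 m, (0 < m)%N & span (entry_set J l) (x *+ m).
Proof.
have [J [indJ Jmax]] := Zorn_bigcup independent_sequences_bigcup.
pose B := span [set y | exists2 i, entries_of J i & y = entry i].
have hB : subgp B by exact: subgp_span.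
pose ext l x := forall d (c : nat -> int),
  B (x *~ d + \sum_(i < size l) l`_i *~ c i) -> (0%:Z %| d)%Z.
have [l hl] : exists l, forall x, ~ ext l x.
  apply: contrapT => no.
  have [|g hg] := @sequence_of_extensions _ ext.
    by move=> l; apply: contrapT => h; apply: no; exists l => x hx; apply: h; exists x.
  have tri m d (c : nat -> int) : B (g m *~ d + \sum_(i < m) g i *~ c i) -> (0%:Z %| d)%Z.
    move=> Bg; apply: (hg m d c); rewrite size_mkseq.
    by under eq_bigr => i _ do rewrite nth_mkseq //.
  have g0 i : B (g i *+ 0) by rewrite mulr0n; case: hB.
  have triC := triangular_comb hB g0 tri.
  have nJg : ~ J g.
    move=> Jg; have := tri 0%N 1 (fun=> 0).
    rewrite big_ord0 addr0 => h; have : (0 %| 1)%Z by apply: h; apply: sub_span;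
      exists (g, 0%N) => //; exact/asboolP.
    by rewrite dvd0z.
  apply: (Jmax (J `|` [set g])).
    by split=> [|h]; [exact: subsetUl|apply: nJg; apply: h; right].
  move=> s sD s0.
  pose s1 := [seq q <- s | q.1.1 != g]; pose s2 := [seq q <- s | q.1.1 == g].
  pose t := [seq (q.1.2, q.2) | q : (nat -> G) * nat * int <- s2].
  have s12 : comb entry s = comb g t + comb entry s1.
    rewrite /comb big_map !big_filter (bigID (fun q => q.1.1 == g)) /=.
    by congr (_ + _); apply: eq_bigr => q /eqP <-.
  have s1J : supported (entries_of J) s1.
    apply/allP => q; rewrite mem_filter => /andP[qg qs].
    have /asboolP [Jq|/= qg'] := allP sD q qs; first exact/asboolP.
    by rewrite qg' eqxx in qg.
  have Bs1 : B (comb entry s1).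
    by apply: comb_in s1J => // i Di; apply: sub_span; exists i.
  have t0 i : (0%:Z %| coef t i)%Z.
    apply: triC; have -> : comb g t = - comb entry s1; last exact: (subgpN hB Bs1).
    by apply/eqP; rewrite -addr_eq0 -s12 s0.
  have gt0 : comb g t = 0 by apply: comb_transfer t0 _ => i; rewrite mulr0n.
  have s10 : comb entry s1 = 0 by move: s12; rewrite s0 gt0 add0r.
  move=> [h n]; have [hg'|hg'] := eqVneq h g.
    have -> : coef s (h, n) = coef t n; last exact: t0.
    rewrite /coef big_map big_filter_cond; apply: eq_bigl => -[[h' n'] c] /=.
    by rewrite hg' xpair_eqE andbC.
  have -> : coef s (h, n) = coef s1 (h, n); last exact: indJ.
  rewrite /coef big_filter_cond; apply: eq_bigl => -[[h' n'] c] /=.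
  by rewrite xpair_eqE; have [->|_] := eqVneq h' h; rewrite ?hg' ?andbF.
exists J, l; split=> // x.
have [d [c Bx nd]] : exists d, exists2 c : nat -> int,
    B (x *~ d + \sum_(i < size l) l`_i *~ c i) & ~ (0%:Z %| d)%Z.
  apply: contrapT => no; apply: (hl x) => d c Bx.
  by apply: contrapT => nd; apply: no; exists d, c.
exists `|d|%N; first by rewrite absz_gt0; apply: contra_notN nd => /eqP ->.
have hS : subgp (span (entry_set J l)) by exact: subgp_span.
have Sx : span (entry_set J l) (x *~ d).
  rewrite -[x *~ d](addrK (\sum_(i < size l) l`_i *~ c i)); apply: (subgpB hS).
    by apply: span_mono Bx => y Dy; left.
  apply: (@subgp_sum _ (span (entry_set J l)) _ _ _ _ hS) => i _.
  by apply: (subgpMz _ hS); apply: sub_span; right; exact: mem_nth.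
by case: (d) Sx => m //= /(subgpN hS); rewrite opprK.
Qed.

Lemma entry_free J s m : independent_sequences J -> supported (entries_of J) s ->
  (0 < m)%N -> comb entry s *+ m = 0 -> forall i, (0%:Z %| coef s i)%Z.
Proof.
move=> indJ sJ m0 sm i.
pose t := [seq (q.1, q.2 * m%:Z) | q <- s].
have tJ : supported (entries_of J) t by rewrite /supported all_map.
have t0 : comb entry t = 0.
  rewrite -sm /comb big_map -sumrMnl; apply: eq_bigr => q _.
  by rewrite /= mulrzA -pmulrn.
have := indJ t tJ t0 i; have -> : coef t i = coef s i * m%:Z.
  by rewrite /coef big_map mulr_suml.
by rewrite !dvd0z mulf_eq0 => /orP[//|/eqP [m0']]; rewrite m0' in m0.
Qed.

End SequenceFamilies.

(** Up to finitely many elements the rank is carried by a nonempty family of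
    sequences. So [G] splits as [A + E] with [E] elementary and [A] generated by
    solutions of [m x = v] modulo torsion, where [v] is an entry of a sequence
    or one of those finitely many elements, by the components of such [v], and
    by finitely many elements for each prime, hence by a family with the same
    index set as the entries of the sequences. Sending these generators to
    the entries embeds [G] in the quotient by a nonzero torsion-free subgroup;
    but such a subgroup is no summand, as the primary projections vanish on
    a torsion-free summand. *)
Lemma infinite_rank_not_gB (G : zmodType) k (pi : nat -> {additive G -> G})
    (J : set (nat -> G)) (l : seq G) (g0 : nat -> G) :
  primary_projections k pi -> (forall p, prime p -> finite_sub (multiples pi p 1)) ->
  independent_sequences J -> J g0 ->
  (forall x, exists2 m, (0 < m)%N & span (entry_set J l) (x *+ m)) ->
  ~ generalized_Bassian G.
Proof.
move=> hpi fin indJ Jg0 hl gB.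
pose D := entries_of J; pose T0 := entry_set J l.
pose V p := span [set x | exists2 y, T0 y & x = pi p y].
have hV p : subgp (V p) by exact: subgp_span.
have V_prim p : prime p -> V p `<=` prim pi p.
  move=> pp; apply: span_min; first exact: subgp_prim.
  by move=> _ [y _ ->]; exact: (prim_pi hpi).
have V_span x p : span T0 x -> V p (pi p x).
  move=> Tx; apply: (Tx [set z | V p (pi p z)]); last first.
    by move=> y Ty; apply: sub_span; exists y.
  split=> [|z w /= Vz Vw]; first by rewrite /= raddf0; case: (hV p).
  by rewrite raddfB; exact: (subgpB (hV p) Vz Vw).
have h p : exists fE : seq G * set G, prime p ->
    let A := sumset (V p) (span [set x | x \in fE.1]) in
    [/\ forall x, x \in fE.1 -> prim pi p x,
        subgp fE.2 /\ fE.2 `<=` prim pi p,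
        forall x, fE.2 x -> x *+ p = 0,
        forall x, A x -> fE.2 x -> x = 0
      & prim pi p `<=` sumset A fE.2].
  have [pp|] := boolP (prime p); last by exists ([::], set0).
  have [|f [E hfE]] := elementary_complement pp (hV p) (V_prim p pp).
    have [L hL] := fin p pp; exists L => _ [y py ->]; apply: hL; by exists y.
  by exists (f, E).
have [fE hfE] := choice h.
pose f p := (fE p).1; pose E p := (fE p).2.
pose A p := sumset (V p) (span [set x | x \in f p]).
have hA p : subgp (A p) by apply: subgp_sumset => //; exact: subgp_span.
have VA p : V p `<=` A p by apply: sumsetl; exact: subgp_span.
have fA p x : x \in f p -> A p x by move=> xf; apply: sumsetr => //; exact: sub_span.
have A_prim p : prime p -> A p `<=` prim pi p.
  move=> pp _ [a [b [/(V_prim p pp) pa sb ->]]]; apply: (subgpD (subgp_prim pi p) pa).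
  by have [fp _ _ _ _] := hfE p pp; apply: (span_min (subgp_prim pi p)) sb.
have [||||hA' hE' dAE] := assemble hpi (A := A) (E := E).
- by move=> p pp; have [_ [? ?] _ _ _] := hfE p pp; split=> //; exact: A_prim.
- by move=> p x pp; have [_ _ _ + _] := hfE p pp; apply.
- by move=> p pp; have [_ _ _ _] := hfE p pp.
- move=> x; have [m m0 xm] := hl x; exists m => // p pp npm; apply: VA.
  apply: (coprime_subgp (hV p) (m := m) (n := (p ^ k p)%N)).
  + by rewrite coprimeXr // coprime_sym prime_coprime.
  + by rewrite -raddfMn; exact: V_span.
  + by rewrite (pi_exp hpi) //; case: (hV p).
move: hA' hE' dAE; set A' := [set x | forall p, _]; set E' := [set x | _ /\ _].
move=> hA' hE' dAE.
have AA' p x : prime p -> A p x -> A' x.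
  move=> pp Ax q pq; have px := A_prim p pp _ Ax.
  have [<-|npq] := eqVneq p q; first by rewrite px.
  by rewrite (prim_neq hpi pp pq npq px); case: (hA q).
have TA' : T0 `<=` A' by move=> y Ty p pp; apply: VA; apply: sub_span; exists y.
have [rho [rhoA rho_id _]] := direct_proj hA' hE' dAE.
pose X v m := xget 0 [set z | A' z /\ torsion_elt (v - z *+ m)].
have XP v m : T0 v -> (0 < m)%N -> A' (X v m) /\ torsion_elt (v - X v m *+ m).
  move=> Tv m0; apply: (@xgetPex _ 0 [set z | A' z /\ torsion_elt (v - z *+ m)]).
  have [z [n n0 hz]] := torsion_divisible hpi v m0.
  exists (rho z); split=> //; exists n => //.
  by rewrite -[v]rho_id; [rewrite -raddfMn -raddfB -raddfMn hz raddf0|exact: TA'].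
have [code codeK] : exists code : nat * nat * nat -> nat, pcancel code unpickle.
  by exists pickle; exact: pickleK.
(* The second index codes what to generate from the sequence; the codes with
   first entry at least five give zero, which makes the kernel nonzero. *)
pose raw (i : (nat -> G) * nat) : G := match unpickle i.2 : option (nat * nat * nat) with
  | Some (0%N, n, m) => X (i.1 n) m
  | Some (1%N, n, m) => pi m (i.1 n)
  | Some (2%N, n, m) => X l`_n m
  | Some (3%N, n, m) => pi m l`_n
  | Some (4%N, n, m) => (f m)`_n
  | _ => 0 end.
pose a i := if `[< A' (raw i) >] then raw i else 0.
have aA i : D i -> A' (a i).
  by rewrite /a => _; case: asboolP => // _; case: hA'.
pose S := span [set y | exists2 i, D i & y = a i].
have hS : subgp S by exact: subgp_span.
have Sraw i : D i -> A' (raw i) -> S (raw i).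
  by move=> Di Ai; apply: sub_span; exists i => //; rewrite /a; case: asboolP.
have Dg g n : J g -> D (g, n) by move=> Jg; exact/asboolP.
have lT n : (n < size l)%N -> T0 l`_n by move=> nl; right; exact: mem_nth.
have SX v m : T0 v -> (0 < m)%N -> S (X v m).
  move=> Tv m0; have [AX _] := XP v m Tv m0.
  case: Tv AX => [[[g n] /asboolP Jg ->]|/(nthP 0) [n nl <-]] AX.
    have := Sraw (g, code (0%N, n, m)) (Dg _ _ Jg).
    by rewrite /raw /= codeK; exact.
  have := Sraw (g0, code (2%N, n, m)) (Dg _ _ Jg0).
  by rewrite /raw /= codeK; exact.
have Spi v p : prime p -> T0 v -> S (pi p v).
  move=> pp Tv; have Ap : A' (pi p v).
    by apply: (AA' p) => //; apply: VA; apply: sub_span; exists v.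
  case: Tv Ap => [[[g n] /asboolP Jg ->]|/(nthP 0) [n nl <-]] Ap.
    have := Sraw (g, code (1%N, n, p)) (Dg _ _ Jg).
    by rewrite /raw /= codeK; exact.
  have := Sraw (g0, code (3%N, n, p)) (Dg _ _ Jg0).
  by rewrite /raw /= codeK; exact.
have Sf p x : prime p -> x \in f p -> S x.
  move=> pp xf; have Ax : A' x by apply: (AA' p) => //; exact: fA.
  case/(nthP 0): xf Ax => n nf <- Ax.
  have := Sraw (g0, code (4%N, n, p)) (Dg _ _ Jg0).
  by rewrite /raw /= codeK; exact.
have SA' : S `<=` A' by apply: span_min => // _ [i Di ->]; exact: aA.
have Stor x : torsion_elt x -> A' x -> S x.
  move=> tx Ax; apply: (torsion_in hpi hS tx) => p pp.
  have [v [w [Vv fw ->]]] := Ax p pp; apply: (subgpD hS).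
    by apply: (span_min hS) Vv => _ [y Ty ->]; exact: Spi.
  by apply: (span_min hS) fw => y; exact: Sf.
have Sgen : A' `<=` S.
  move=> x Ax; have [m m0 xm] := hl x.
  have [y [Sy txy]] : exists y, S y /\ torsion_elt (x *+ m - y *+ m).
    apply: (xm [set w | exists y, S y /\ torsion_elt (w - y *+ m)]).
      have ht := subgp_torsion G.
      split; first by exists 0; rewrite mul0rn subrr; split; [case: hS|case: ht].
      move=> w w' [y [Sy ty]] [y' [Sy' ty']]; exists (y - y'); split.
        exact: (subgpB hS).
      have -> : w - w' - (y - y') *+ m = (w - y *+ m) - (w' - y' *+ m).
        by rewrite mulrnBl !opprB [y' *+ m - _]addrC addrACA [- w' + _]addrC.
      exact: subgpB.
    by move=> v Tv; exists (X v m); split; [exact: SX|case: (XP v m Tv m0)].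
  rewrite -[x](subrK y); apply: (subgpD hS) => //; apply: Stor.
    by apply: (torsion_eltMn m0); rewrite mulrnBl.
  by apply: (subgpB hA') => //; exact: SA'.
pose N := [set y | exists s, [/\ supported D s, comb a s = 0 & y = comb (@entry G) s]].
have hN : subgp N.
  split; first by exists [::]; rewrite !comb_nil.
  move=> _ _ [s [sD s0 ->]] [t [tD t0 ->]]; exists (s ++ oppc t); split.
  - exact: supported_subc.
  - by rewrite comb_subc s0 t0 subrr.
  - by rewrite comb_subc.
have free := entry_free indJ.
have transfer s m : supported D s -> (0 < m)%N -> comb (@entry G) s *+ m = 0 ->
    forall b : (nat -> G) * nat -> G, comb b s = 0.
  by move=> sD m0 sm b; apply: comb_transfer (free _ _ sD m0 sm) _ => i; rewrite mulr0n.
have emb : embeds_in_quotient (pack hN).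
  apply: (relocation_embeds (D := D) (a := a) (u := @entry G) hN hE' dAE) => //.
  - by move=> s sD s0; exists s.
  - move=> s e sD [[m m0 em] _] [t [tD t0 ste]].
    have sme : e = comb (@entry G) (t ++ oppc s) by rewrite comb_subc -ste addrC addKr.
    have tsD := supported_subc tD sD.
    have em' := em; rewrite sme in em'.
    have ts0 := transfer _ _ tsD m0 em'.
    split; last by rewrite sme ts0.
    by have := ts0 a; rewrite comb_subc t0 sub0r => /eqP; rewrite oppr_eq0 => /eqP.
have [K hK dNK] := gB_summand gB emb.
have [r [rN r_id _]] := direct_proj hN hK dNK.
have Ntf y m : N y -> (0 < m)%N -> y *+ m = 0 -> y = 0.
  by move=> [s [sD _ ->]] m0 ym; exact: transfer sD m0 ym _.
pose i0 := (g0, code (5%N, 0%N, 0%N)).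
have Di0 : supported D [:: (i0, 1)] by rewrite /= andbT; exact: Dg.
have Ny : N (entry i0).
  exists [:: (i0, 1)]; rewrite !comb1; split=> //.
  by rewrite /a /raw /= codeK; case: ifP.
have y0 : entry i0 = 0.
  apply: (pi_separate hpi) => p pp; rewrite -(r_id _ Ny) -(pi_natural hpi) //.
  apply: (Ntf _ (p ^ k p)%N) => //; first by rewrite expn_gt0 prime_gt0.
  by rewrite -raddfMn (pi_exp hpi) // raddf0.
have := indJ _ Di0; rewrite comb1 => /(_ y0 i0).
by rewrite /coef big_cons big_nil eqxx addr0.
Qed.

Lemma gB_finite_rank (G : zmodType) k (pi : nat -> {additive G -> G}) :
  primary_projections k pi -> generalized_Bassian G -> finite_rank G.
Proof.
move=> hpi gB; have [J [l [indJ hl]]] := maximal_sequences G.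
have [[g0 Jg0]|J0] := pselect (exists g, J g).
  exfalso; apply: (infinite_rank_not_gB hpi _ indJ Jg0 hl gB) => p.
  exact: (gB_finite_multiples hpi).
exists l => x; have [m m0 xm] := hl x; exists m => //.
apply: span_mono xm => y [[[g n] /asboolP Jg _]|//].
by exfalso; apply: J0; exists g.
Qed.


(** * Pure subgroups of products *)

Lemma dirprodMn (I : Type) (T : I -> zmodType) (x : dirprod T) n i :
  (x *+ n) i = x i *+ n.
Proof. by elim: n => [|n IHn]; rewrite ?mulr0n // !mulrS -IHn. Qed.

(** The component of [x] at [p] lies in the group, which contains the direct
    sum. The other components have orders prime to [p], so they are jointly
    divisible by powers of [p] in the product, hence in the group by purity. *)
Lemma PSP_projections (G : zmodType) : PSP G ->
  exists k, exists pi : nat -> {additive G -> G}, primary_projections k pi.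
Proof.
move=> [T [Tb [H [Hpure Hsum [phi phi_bij]]]]].
pose psi (x : G) : dirprod T := val (phi x).
have psiB x y : psi (x - y) = psi x - psi y by rewrite /psi raddfB.
have psi0 : psi 0 = 0 by rewrite -(subrr 0) psiB subrr.
have psiMn x n : psi (x *+ n) = psi x *+ n by rewrite /psi raddfMn subgroup_valMn.
have psiI : injective psi by move=> x y /val_inj; exact: (bij_inj phi_bij).
have psiH x : psi x \in H by exact: valP.
have psi_onto h : h \in H -> exists x, psi x = h.
  move=> hH; have [g _ gK] := phi_bij; exists (g (Subgroup hH)).
  by rewrite /psi gK.
have [b bP] := choice Tb.
pose k p := if insub p is Some P then (b P).+1 else 0%N : nat.
have kE (P : prime_number) : k (sval P) = (b P).+1.
  by rewrite /k -[sval P]/(val P) valK.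
have Tk (P : prime_number) (x : T P) : x *+ (sval P ^ k (sval P)) = 0.
  by rewrite kE expnSr mulrnA bP mul0rn.
pose cut p (h : dirprod T) : dirprod T := fun Q => if sval Q == p then h Q else 0.
have cutH p h : cut p h \in H.
  apply: Hsum; have [pp|npp] := boolP (prime p).
    apply: (@sub_finite_set _ _ [set exist _ p pp : prime_number]); last exact: finite_set1.
    move=> [q pq]; rewrite /= /cut /=; case: ifP => [/eqP e _|_]; last by rewrite eqxx.
    by subst q; congr exist; exact: bool_irrelevance.
  apply: (@sub_finite_set _ _ set0); last exact: finite_set0.
  move=> [q pq] /=; rewrite /cut /=; case: ifP => [/eqP e|_]; last by rewrite eqxx.
  by rewrite -e pq in npp.
have proj p : exists f : {additive G -> G}, forall x, psi (f x) = cut p (psi x).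
  have [f fP] := choice (fun x => psi_onto _ (cutH p (psi x))).
  have fB : {morph f : x y / x - y}.
    move=> x y; apply: psiI; rewrite psiB !fP psiB.
    apply: functional_extensionality_dep => Q.
    rewrite /cut -[RHS]/(cut p (psi x) Q - cut p (psi y) Q) /cut.
    by case: eqP => _; rewrite ?subrr.
  by have [g gE] := additive_exists fB; exists g => x; rewrite gE.
have [pi piE] := choice proj.
have copr (P Q : prime_number) m n : sval Q != sval P ->
    coprime (sval Q ^ m) (sval P ^ n).
  by move=> ne; rewrite coprimeXl // coprimeXr // prime_coprime ?dvdn_prime2 //;
     [exact: (svalP Q)|exact: (svalP P)|exact: (svalP Q)].
exists k, pi; split.
- by move=> p pp; rewrite -[p]/(sval (exist (fun p => prime p) p pp : prime_number)) kE.
- move=> p x pp; apply: psiI; rewrite psiMn piE psi0.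
  apply: functional_extensionality_dep => Q.
  rewrite dirprodMn /cut; case: eqP => [e|_]; last by rewrite mul0rn.
  by rewrite -e Tk.
- move=> p n x pp xn; pose P : prime_number := exist _ p pp.
  apply: psiI; rewrite piE; apply: functional_extensionality_dep => Q.
  rewrite /cut; case: ifPn => // ne; apply/esym.
  apply: (coprime_order (copr P Q (k (sval Q)) n ne)); first exact: Tk.
  by rewrite -dirprodMn -psiMn xn psi0.
- move=> p x pp; pose P : prime_number := exist _ p pp.
  pose y := psi (x - pi p x).
  have yE Q : y Q = if sval Q == p then 0 else psi x Q.
    rewrite /y psiB piE -[LHS]/(psi x Q - cut p (psi x) Q) /cut.
    by case: ifP; rewrite ?subrr ?subr0.
  have ydiv Q : exists z : T Q, y Q = z *+ (p ^ k p).
    rewrite yE; case: ifPn => [_|ne]; first by exists 0; rewrite mul0rn.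
    pose M : set (T Q) := [set t | exists z, t = z *+ (p ^ k p)].
    have hM : subgp M.
      split; first by exists 0; rewrite mul0rn.
      by move=> _ _ [z ->] [w ->]; exists (z - w); rewrite mulrnBl.
    apply: (coprime_subgp hM (copr P Q (k (sval Q)) (k p) ne)).
      by rewrite Tk; case: hM.
    by exists (psi x Q).
  have [|||h hH hy] := Hpure (p ^ k p)%N y.
  + by rewrite expn_gt0 prime_gt0.
  + exact: psiH.
  + exists (fun Q => xget 0 [set z : T Q | y Q = z *+ (p ^ k p)]).
    apply: functional_extensionality_dep => Q; rewrite dirprodMn.
    exact/esym/(xgetPex (P := [set z : T Q | y Q = z *+ (p ^ k p)]) 0 (ydiv Q)).
  have [z zh] := psi_onto h hH.
  by exists z; apply: psiI; rewrite psiMn zh hy.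
- move=> x x0; apply: psiI; rewrite psi0; apply: functional_extensionality_dep => Q.
  have := piE (sval Q) x; rewrite x0 ?psi0; last exact: (svalP Q).
  by move=> /(congr1 (fun h : dirprod T => h Q)); rewrite /cut eqxx => <-.
Qed.

(** * The characterization *)

(** A Bassian summand is generalized Bassian, so it has finite rank and its
    components have finitely many multiples of [p]; an elementary complement
    changes neither. *)
Lemma BplusE_finite (G : zmodType) k (pi : nat -> {additive G -> G}) :
  primary_projections k pi -> BplusE G ->
  finite_rank G /\ forall p, prime p -> finite_sub (multiples pi p 1).
Proof.
move=> hpi [A [E [dAE BA [tE eE]]]].
have [pi' [hpi' pi'E]] := summand_projections hpi dAE.
have gBA : generalized_Bassian (subgroup A).
  move=> N /BA N0; exists (pack (S := [set: subgroup A]) (conj I (fun _ _ _ _ => I))).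
  split=> [x /N0 //|x]; exists 0, x; rewrite add0r rpred0; split=> //.
  exact/packP.
have torE e : e \in E -> torsion_elt e.
  move=> eE'; have [n n0 en] := tE (Subgroup eE'); exists n => //.
  by rewrite -[e]/(val (Subgroup eE')) -subgroup_valMn en.
split.
  have [l hl] := gB_finite_rank hpi' gBA; exists (map val l) => x.
  have [a [e [Aa Ee ->]]] := dAE.2 x; have [n n0 en] := torE e Ee.
  have [m m0 am] := hl (Subgroup Aa).
  exists (m * n)%N; first by rewrite muln_gt0 m0.
  rewrite mulrnDl [e *+ _]mulrnA [e *+ _ *+ _]mulrnAC en mul0rn addr0 mulrnA.
  apply: (subgpMn _ (subgp_span _)).
  rewrite -[a]/(val (Subgroup Aa)) -subgroup_valMn.
  apply: (am [set z | span [set y | y \in map val l] (val z)]).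
    have hs := subgp_span [set y | y \in map val l].
    split=> [|z w /= sz sw]; first by case: hs.
    exact: (subgpB hs sz sw).
  by move=> y yl; apply: sub_span; exact: map_f.
move=> p pp; have [L hL] := gB_finite_multiples hpi' gBA pp.
exists (map val L) => _ [y py ->].
have [rho [rhoA rho_id rhoE]] := direct_proj (subgp_mem A) (subgp_mem E) dAE.
have -> : y *+ (p ^ 1) = val (Subgroup (rhoA y) *+ (p ^ 1)).
  rewrite subgroup_valMn /= expn1; apply/eqP; rewrite -subr_eq0 -mulrnBl; apply/eqP.
  rewrite -[y - rho y]/(val (Subgroup (rhoE y))) -subgroup_valMn.
  rewrite (eE p pp) //; exists (k p); apply: val_inj; rewrite subgroup_valMn /=.
  by rewrite mulrnBl -raddfMn (prim_exp hpi) // raddf0 subrr.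
apply: map_f; apply: hL; exists (Subgroup (rhoA y)) => //.
by apply: val_inj; rewrite pi'E //= -(pi_natural hpi) // py.
Qed.

Theorem corollary4p9 (G : zmodType) (hG : PSP G) :
  generalized_Bassian G <-> BplusE G.
Proof.
have [k [pi hpi]] := PSP_projections hG; split=> [gB|BE].
  have [l hl] := gB_finite_rank hpi gB.
  by apply: (finite_rank_BplusE hpi hl) => p; exact: (gB_finite_multiples hpi).
have [[l hl] fin] := BplusE_finite hpi BE.
exact: (finite_rank_gB hpi hl fin).
Qed.
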